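(* Let $\lambda_0\in\mathbb{C}$ be an isolated singularity of the functions $w_1(\lambda)$ and $w_2(\lambda)$. Then $$\operatorname*{reglim}_{\lambda\to\lambda_0}\left[\alpha_1w_1(\lambda)+\alpha_2w_2(\lambda)\right]=\alpha_1\operatorname*{reglim}_{\lambda\to\lambda_0}w_1(\lambda)+\alpha_2\operatorname*{reglim}_{\lambda\to\lambda_0}w_2(\lambda)$$ for all complex numbers $\alpha_1$ and $\alpha_2$.
   Context: Functions are of a complex variable, analytic in a domain except at isolated interior points. Isolated singularities may be removable, poles or essential. Regularized limit: if $w$ is analytic in a punctured disk around $\lambda_0$ with Laurent expansion $\sum_{k\in\mathbb{Z}}a_k(\lambda-\lambda_0)^k$ there, and $w_P(\lambda|\lambda_0)=\sum_{k\ge1}a_{-k}(\lambda-\lambda_0)^{-k}$ is its principal part, then $\operatorname{reglim}_{\lambda\to\lambda_0}w(\lambda)=\lim_{\lambda\to\lambda_0}[w(\lambda)-w_P(\lambda|\lambda_0)]$. *)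

(* Defs.v *)
From Stdlib Require Import Reals ZArith.
From Coquelicot Require Import Coquelicot.
Open Scope C_scope.

Definition punctured_disk (z0 : C) (r : R) (z : C) : Prop :=
  (0 < Cmod (z - z0) < r)%R.

(* Removable singularities (hence also regular points), poles and essential
   singularities are all included.  Functions are total on [C]: the value of
   [w] at [z0] is irrelevant here and in everything below.  Differentiability
   is over the field [C], i.e. complex differentiability. *)
Definition isolated_singularity (w : C -> C) (z0 : C) : Prop :=
  exists r : R, (0 < r)%R /\
    forall z : C, punctured_disk z0 r z ->
      @ex_derive C_AbsRing C_NormedModule w z.

(* [is_series] over [C] starts at index 0, so index [k] of the principal part
   stands for the exponent [-(k+1)]. *)
Definition is_regular_sum (a : Z -> C) (z0 z s : C) : Prop :=
  @is_series C_AbsRing C_NormedModule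
    (fun k : nat => a (Z.of_nat k) * (z - z0) ^ k) s.

Definition is_principal_sum (a : Z -> C) (z0 z s : C) : Prop :=
  @is_series C_AbsRing C_NormedModule
    (fun k : nat => a (- Z.of_nat (S k))%Z / (z - z0) ^ (S k)) s.

(* A two-sided series converges when its two halves converge separately. *)
Definition is_laurent (w : C -> C) (z0 : C) (a : Z -> C) : Prop :=
  exists r : R, (0 < r)%R /\
    forall z : C, punctured_disk z0 r z ->
      exists s t : C,
        is_regular_sum a z0 z s /\ is_principal_sum a z0 z t /\ w z = s + t.

(* [iota] picks the unique object with a property (and is junk if there is
   none): Laurent coefficients at an isolated singularity exist and are unique,
   whatever punctured disk is used. *)
Definition principal_part (w : C -> C) (z0 z : C) : C :=
  @iota C_CompleteNormedModule (fun s : C =>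
    exists a : Z -> C, is_laurent w z0 a /\ is_principal_sum a z0 z s).

(* Coquelicot's [C_lim] only inspects the approach along the horizontal line
   through [z0]; this is the full two-dimensional limit, with which [C_lim]
   agrees whenever it exists (see [is_C_lim_unique]). *)
Definition limC (f : C -> C) (z0 : C) : C :=
  @iota C_CompleteNormedModule (fun l : C =>
    filterlim f (@locally' C_UniformSpace z0) (@locally C_UniformSpace l)).

Definition reglim (w : C -> C) (z0 : C) : C :=
  limC (fun z => w z - principal_part w z0 z) z0.

(* Main.v *)
Require Import Defs.
From Stdlib Require Import Reals ZArith Lra Lia Classical ClassicalEpsilon.
From Coquelicot Require Import Coquelicot.
Open Scope C_scope.

(** Near an isolated singularity [z0] a function has a Laurent expansion with
    coefficients [a]; subtracting the principal part leaves the power series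
    of nonnegative exponents, whose limit at [z0] is its constant term.  So the
    regularized limit is the coefficient [a 0] ([reglim_laurent]).  A linear
    combination of Laurent expansions is an expansion of the linear
    combination ([is_laurent_lincomb]), and the theorem is the resulting
    equality of coefficients of index 0.

    Two facts are needed for this: that the expansion exists
    ([isolated_singularity_laurent]), and that the principal part does not
    depend on the expansion chosen ([laurent_principal_unique]).  Both rest on
    the integral of a function over a circle [|z| = r] with respect to the
    angle, [circ_int f r].

    Existence.  In the logarithmic coordinate [s], with [z = exp s], an annulus
    becomes a rectangle whose horizontal sides carry equal values of the
    [2 pi i]-periodic function [f (exp s)].  Goursat's theorem for rectangles
    ([goursat_rectangle], proved by bisection, so that mere differentiability
    suffices) therefore says that [circ_int f r] does not depend on [r]
    ([circ_int_holo_const]).  Since a circular integral of a continuous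
    function is continuous in [r], this remains true across a circle on which
    the function is only continuous ([circ_int_const_across]).  Applied to the
    difference quotient [y * (f y - f z) / (y - z)] this is Cauchy's formula on
    an annulus ([cauchy_annulus]), and expanding the kernel [y / (y - z)] in
    geometric series on the two boundary circles gives the two halves of the
    Laurent series.

    Uniqueness.  The difference of two expansions is an expansion of 0; multiply
    it by [y ^ (j + 1)] and integrate it term by term over a circle.  Only
    the term of index [- (j + 1)] has a nonzero integral
    ([circ_int_pow_quot_0]), so its coefficient vanishes. *)

(** * Complex continuity and differentiability *)

Notation holo := (@ex_derive C_AbsRing C_NormedModule).
Notation ccont := (@continuous C_UniformSpace C_UniformSpace).

(* Equalities produced by the generic lemmas live in the carrier of some
   structure on [C], where [ring] and [field] do not recognise the type. *)
Ltac C_eq := cbv beta; match goal with |- @eq _ ?x ?y => change (@eq C x y) end.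

(** The uniform structure of [C] is that of the product [R * R], with square
    balls, whereas differentiability over [C] uses the discs of [Cmod]; the two
    give the same neighbourhoods. *)
Lemma locally_Cmod (z : C) (P : C -> Prop) :
  @locally C_UniformSpace z P <->
  exists d : R, (0 < d)%R /\ forall y, (Cmod (y - z) < d)%R -> P y.
Proof.
  rewrite (locally_C z P). split.
  - intros [d H]. exists d. split. apply cond_pos. intros y Hy. apply H. exact Hy.
  - intros [d [Hd H]]. exists (mkposreal d Hd). intros y Hy. apply H. exact Hy.
Qed.

Lemma continuous_Cmod {U : UniformSpace} (f : U -> C) (x : U) :
  @continuous U C_UniformSpace f x <->
  forall e : R, (0 < e)%R -> locally x (fun y => Cmod (f y - f x) < e)%R.
Proof.
  split.
  - intros H e He. apply (H (fun v => Cmod (v - f x) < e)%R).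
    apply locally_Cmod. exists e. auto.
  - intros H P HP. apply locally_Cmod in HP. destruct HP as [d [Hd HP]].
    unfold filtermap. generalize (H d Hd). apply filter_imp. auto.
Qed.

Lemma ccont_Cmod (f : C -> C) (z : C) :
  ccont f z <->
  forall e : R, (0 < e)%R -> exists d : R, (0 < d)%R /\
    forall y, (Cmod (y - z) < d)%R -> (Cmod (f y - f z) < e)%R.
Proof.
  rewrite continuous_Cmod.
  split; intros H e He; specialize (H e He); now apply locally_Cmod.
Qed.

(** The form of the derivative used by all estimates below. *)
Lemma is_C_derive_Cmod (f : C -> C) (z l : C) :
  @is_derive C_AbsRing C_NormedModule f z l <->
  forall e : R, (0 < e)%R -> exists d : R, (0 < d)%R /\
    forall y, (Cmod (y - z) < d)%R ->
      (Cmod (f y - f z - (y - z) * l) <= e * Cmod (y - z))%R.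
Proof.
  split.
  - intros [_ H] e He.
    destruct (H z (fun P HP => HP) (mkposreal e He)) as [d Hd].
    exists d. split. apply cond_pos. intros y Hy. apply Hd. exact Hy.
  - intros H. split. apply is_linear_scal_l.
    intros x Hx.
    apply (@is_filter_lim_locally_unique C_AbsRing (AbsRing_NormedModule C_AbsRing)) in Hx.
    simpl in Hx; subst x.
    intros e. destruct (H e (cond_pos e)) as [d [Hd Hy]].
    exists (mkposreal d Hd). intros y Hyd. apply Hy. exact Hyd.
Qed.

Lemma holo_ccont (f : C -> C) (z : C) : holo f z -> ccont f z.
Proof.
  intros H. apply ex_derive_continuous in H.
  intros P HP. apply locally_C. exact (H P HP).
Qed.

(** Products are continuous for the structure defined by [Cmod]; this moves the
    fact to the product structure of [R * R]. *)
Lemma continuous_C_AbsRing {U : UniformSpace} (f : U -> C) (x : U) :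
  @continuous U C_UniformSpace f x <->
  @continuous U (AbsRing_UniformSpace C_AbsRing) f x.
Proof.
  split; intros H P HP; apply H; now apply locally_C.
Qed.

Lemma Ccontinuous_mult {U : UniformSpace} (f g : U -> C) (x : U) :
  @continuous U C_UniformSpace f x -> @continuous U C_UniformSpace g x ->
  @continuous U C_UniformSpace (fun y => f y * g y) x.
Proof.
  rewrite 3!continuous_C_AbsRing. apply (@continuous_mult U C_AbsRing).
Qed.

Lemma Ccontinuous_plus {U : UniformSpace} (f g : U -> C) (x : U) :
  @continuous U C_UniformSpace f x -> @continuous U C_UniformSpace g x ->
  @continuous U C_UniformSpace (fun y => f y + g y) x.
Proof. apply (@continuous_plus U C_AbsRing C_NormedModule). Qed.

Lemma Ccontinuous_minus {U : UniformSpace} (f g : U -> C) (x : U) :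
  @continuous U C_UniformSpace f x -> @continuous U C_UniformSpace g x ->
  @continuous U C_UniformSpace (fun y => f y - g y) x.
Proof. apply (@continuous_minus U C_AbsRing C_NormedModule). Qed.

Lemma is_C_derive_AbsRing (f : C -> C) (z l : C) :
  @is_derive C_AbsRing C_NormedModule f z l <->
  @is_derive C_AbsRing (AbsRing_NormedModule C_AbsRing) f z l.
Proof.
  split; intros [[a b c] h]; (split; [split; assumption | exact h]).
Qed.

Lemma holo_const (c z : C) : holo (fun _ => c) z.
Proof. apply (@ex_derive_const C_AbsRing C_NormedModule). Qed.

Lemma holo_id (z : C) : holo (fun y => y) z.
Proof. exists (RtoC 1). apply is_C_derive_AbsRing. apply (@is_derive_id C_AbsRing). Qed.

Lemma holo_minus (f g : C -> C) (z : C) :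
  holo f z -> holo g z -> holo (fun y => f y - g y) z.
Proof. apply (@ex_derive_minus C_AbsRing C_NormedModule). Qed.

Lemma holo_mult (f g : C -> C) (z : C) :
  holo f z -> holo g z -> holo (fun y => f y * g y) z.
Proof.
  intros [l Hl] [m Hm]. apply is_C_derive_AbsRing in Hl, Hm.
  eexists. apply is_C_derive_AbsRing.
  apply (@is_derive_mult C_AbsRing f g z l m Hl Hm). exact Cmult_comm.
Qed.

Lemma holo_comp (f g : C -> C) (z : C) :
  holo f (g z) -> holo g z -> holo (fun y => f (g y)) z.
Proof.
  intros [l Hl] [m Hm]. apply is_C_derive_AbsRing in Hm.
  eexists. apply (@is_derive_comp C_AbsRing C_NormedModule f g z l m Hl Hm).
Qed.

Lemma holo_pow (n : nat) (z : C) : holo (fun y => y ^ n) z.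
Proof.
  induction n as [|n IH]. exact (holo_const 1 z).
  apply (holo_mult (fun y => y)). apply holo_id. exact IH.
Qed.

Lemma Cmod_minus_sym (x y : C) : Cmod (x - y) = Cmod (y - x).
Proof. rewrite <- Cmod_opp. f_equal. ring. Qed.

Lemma Cmod_triangle_minus (x y : C) : (Cmod x <= Cmod y + Cmod (x - y))%R.
Proof. replace x with (y + (x - y)) at 1 by ring. apply Cmod_triangle. Qed.

(** The remainder [1 / y - 1 / z + (y - z) / z ^ 2] equals
    [(y - z) ^ 2 / (z ^ 2 y)], and [|y| > |z| / 2] for [y] close to [z]. *)
Lemma holo_inv (z : C) : z <> 0 -> holo Cinv z.
Proof.
  intros Hz. exists (- / (z * z)). apply is_C_derive_Cmod. intros e He.
  assert (Hm : (0 < Cmod z)%R) by now apply Cmod_gt_0.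
  set (m := Cmod z) in *.
  exists (Rmin (m / 2) (e * m ^ 3 / 2))%R. split.
  { apply Rmin_glb_lt. lra. apply Rdiv_lt_0_compat; [|lra].
    apply Rmult_lt_0_compat; [lra|]. now apply pow_lt. }
  intros y Hy.
  assert (Hy1 : (Cmod (y - z) < m / 2)%R)
    by (eapply Rlt_le_trans; [exact Hy | apply Rmin_l]).
  assert (Hy2 : (Cmod (y - z) < e * m ^ 3 / 2)%R)
    by (eapply Rlt_le_trans; [exact Hy | apply Rmin_r]).
  assert (Hym : (m / 2 < Cmod y)%R).
  { generalize (Cmod_triangle_minus z y). fold m. rewrite Cmod_minus_sym. lra. }
  assert (Hy0 : y <> 0) by (apply Cmod_gt_0; lra).
  replace (/ y - / z - (y - z) * - / (z * z))
    with ((y - z) * ((y - z) / (z * z * y))) by (field; auto).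
  rewrite Cmod_mult, Rmult_comm. apply Rmult_le_compat_r. apply Cmod_ge_0.
  rewrite Cmod_div by (repeat apply Cmult_neq_0; auto).
  rewrite !Cmod_mult. fold m.
  assert (0 < m * m * Cmod y)%R by (repeat apply Rmult_lt_0_compat; lra).
  apply Rle_div_l; [lra|].
  apply Rlt_le, (Rlt_le_trans _ _ _ Hy2).
  replace (e * m ^ 3 / 2)%R with ((e * (m * m)) * (m / 2))%R by field.
  replace (e * (m * m * Cmod y))%R with ((e * (m * m)) * Cmod y)%R by ring.
  apply Rmult_le_compat_l; [|lra].
  apply Rmult_le_pos; [lra|]. apply Rmult_le_pos; lra.
Qed.

Definition cexp (s : C) : C := (exp (fst s) * cos (snd s), exp (fst s) * sin (snd s))%R.

Lemma cexp_plus s t : cexp (s + t) = cexp s * cexp t.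
Proof.
  unfold cexp, Cmult, Cplus; simpl. rewrite exp_plus, cos_plus, sin_plus. f_equal; ring.
Qed.

Lemma Cmod_cexp s : Cmod (cexp s) = exp (fst s).
Proof.
  unfold Cmod, cexp; simpl.
  replace (_ + _)%R with ((exp (fst s))^2 * ((sin (snd s))² + (cos (snd s))²))%R
    by (unfold Rsqr; ring).
  rewrite sin2_cos2, Rmult_1_r. apply sqrt_pow2. apply Rlt_le, exp_pos.
Qed.

Lemma Cmod_le_sum (a b : R) : (Cmod (a, b) <= Rabs a + Rabs b)%R.
Proof.
  replace ((a, b) : C) with (RtoC a + RtoC b * Ci)
    by (unfold RtoC, Ci, Cplus, Cmult; simpl; f_equal; ring).
  eapply Rle_trans. apply Cmod_triangle.
  rewrite Cmod_mult, Cmod_Ci, Rmult_1_r, !Cmod_R. lra.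
Qed.

Lemma is_derive_0_Rabs (f : R -> R) (l e : R) :
  is_derive f 0 l -> (0 < e)%R ->
  exists d : R, (0 < d)%R /\
    forall x, (Rabs x < d)%R -> (Rabs (f x - f 0 - x * l) <= e * Rabs x)%R.
Proof.
  intros [_ H] He.
  destruct (H 0%R (fun P HP => HP) (mkposreal e He)) as [d Hd].
  exists d. split. apply cond_pos. intros x Hx.
  specialize (Hd x). unfold norm, minus, plus, opp, scal in Hd; simpl in Hd.
  unfold abs, mult in Hd; simpl in Hd.
  replace (x + - 0)%R with x in Hd by ring.
  unfold Rminus. apply Hd.
  unfold ball; simpl. unfold AbsRing_ball, abs, minus, plus, opp; simpl.
  replace (x + - 0)%R with x by ring. exact Hx.
Qed.

(** With [s = x + i y] and [E = exp (i y)], the remainder [exp s - 1 - s] is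
    [(exp x - 1 - x) E + (E - 1 - i y) + x (E - 1)]; the first two terms are
    controlled by the real derivatives of [exp], [cos] and [sin] at 0, and the
    last one is of second order. *)
Lemma is_derive_cexp_0 : @is_derive C_AbsRing C_NormedModule cexp (RtoC 0) (RtoC 1).
Proof.
  apply is_C_derive_Cmod. intros e0 He0.
  (* The three terms are bounded by [e m], [2 e m] and [3 e m], where [m = |s|]. *)
  set (e := Rmin 1 (e0 / 8)).
  assert (He : (0 < e)%R) by (apply Rmin_glb_lt; lra).
  assert (He1 : (e <= 1)%R) by apply Rmin_l.
  assert (He8 : (8 * e <= e0)%R) by (unfold e; generalize (Rmin_r 1 (e0 / 8)); lra).
  destruct (is_derive_0_Rabs exp 1 e) as [d1 [Hd1 H1]]; auto.
  { replace 1%R with (exp 0) by apply exp_0. apply is_derive_exp. }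
  destruct (is_derive_0_Rabs cos 0 e) as [d2 [Hd2 H2]]; auto.
  { replace 0%R with (- sin 0)%R at 2 by (rewrite sin_0; ring). apply is_derive_cos. }
  destruct (is_derive_0_Rabs sin 1 e) as [d3 [Hd3 H3]]; auto.
  { replace 1%R with (cos 0) by apply cos_0. apply is_derive_sin. }
  rewrite exp_0 in H1. rewrite cos_0 in H2. rewrite sin_0 in H3.
  exists (Rmin (Rmin d1 e) (Rmin d2 d3)). split.
  { apply Rmin_glb_lt; apply Rmin_glb_lt; assumption. }
  intros [x y] Hxy.
  replace ((x, y) - 0) with ((x, y) : C) in *
    by (unfold Cminus, Cplus, Copp, RtoC; simpl; f_equal; ring).
  generalize (Rmin_l (Rmin d1 e) (Rmin d2 d3)) (Rmin_r (Rmin d1 e) (Rmin d2 d3))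
    (Rmin_l d1 e) (Rmin_r d1 e) (Rmin_l d2 d3) (Rmin_r d2 d3); intros.
  generalize (Rmax_Cmod (x, y)); simpl; intros Hm.
  assert (Hx := Rmax_l (Rabs x) (Rabs y)). assert (Hy := Rmax_r (Rabs x) (Rabs y)).
  set (m := Cmod (x, y)) in *.
  specialize (H1 x ltac:(lra)). specialize (H2 y ltac:(lra)). specialize (H3 y ltac:(lra)).
  set (E := cexp (0%R, y)).
  assert (HE : E = (cos y, sin y)) by (unfold E, cexp; simpl; rewrite exp_0; f_equal; ring).
  assert (HmE : Cmod E = 1%R) by (unfold E; rewrite Cmod_cexp; simpl; apply exp_0).
  replace (cexp (x, y) - cexp 0 - (x, y) * 1)
    with (RtoC (exp x - 1 - x * 1) * E
          + ((cos y - 1 - y * 0)%R, (sin y - 0 - y * 1)%R)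
          + RtoC x * ((cos y - 1 - y * 0)%R, (sin y - 0 - y * 1 + y)%R)).
  2:{ rewrite HE. unfold cexp, Cminus, Cplus, Cmult, Copp, RtoC; simpl.
      rewrite exp_0, cos_0, sin_0. f_equal; ring. }
  set (u := (exp x - 1 - x * 1)%R) in *. set (v := (cos y - 1 - y * 0)%R) in *.
  set (w := (sin y - 0 - y * 1)%R) in *.
  eapply Rle_trans. apply Cmod_triangle.
  eapply Rle_trans. apply Rplus_le_compat_r. apply Cmod_triangle.
  rewrite !Cmod_mult, HmE, !Cmod_R.
  assert (B1 := Cmod_le_sum v w). assert (B2 := Cmod_le_sum v (w + y)).
  assert (B3 := Rabs_triang w y).
  assert (A0 := Rabs_pos x). assert (A1 := Rabs_pos y).
  assert (A2 := Rabs_pos v). assert (A3 := Rabs_pos w).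
  assert (M1 : (e * Rabs x <= e * m)%R) by (apply Rmult_le_compat_l; lra).
  assert (M2 : (e * Rabs y <= e * m)%R) by (apply Rmult_le_compat_l; lra).
  assert (M3 : (e * Rabs y <= Rabs y)%R) by nra.
  assert (M4 : (Rabs x * Cmod (v, w + y)%R <= e * (3 * m))%R).
  { apply Rmult_le_compat; try lra. apply Cmod_ge_0. }
  assert (8 * e * m <= e0 * m)%R by (apply Rmult_le_compat_r; lra).
  lra.
Qed.

(** The addition formula moves differentiability from 0 to any point. *)
Lemma holo_cexp (s : C) : holo cexp s.
Proof.
  apply (@ex_derive_ext C_AbsRing C_NormedModule (fun t => cexp s * cexp (t - s))).
  { intros t. rewrite <- cexp_plus. f_equal. ring. }
  apply holo_mult. apply holo_const.
  apply (holo_comp cexp (fun t => t - s)).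
  - replace (s - s) with (RtoC 0) by ring. exists (RtoC 1). apply is_derive_cexp_0.
  - apply holo_minus. apply holo_id. apply holo_const.
Qed.

(** * Integrals of complex functions of a real variable *)

Notation is_CInt := (@is_RInt C_R_NormedModule).

Definition CInt (f : R -> C) (a b : R) : C :=
  (RInt (fun t => fst (f t)) a b, RInt (fun t => snd (f t)) a b).

Definition curve_cont (f : R -> C) (a b : R) : Prop :=
  forall t : R, (a <= t <= b)%R -> @continuous R_UniformSpace C_UniformSpace f t.

Lemma CInt_correct (f : R -> C) (a b : R) : (a <= b)%R -> curve_cont f a b ->
  is_CInt f a b (CInt f a b).
Proof.
  intros Hab Hf.
  apply (@is_RInt_fct_extend_pair R_NormedModule R_NormedModule);
    apply (@RInt_correct R_CompleteNormedModule);
    apply (@ex_RInt_continuous R_CompleteNormedModule);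
    rewrite Rmin_left, Rmax_right by assumption; intros t Ht;
    apply (continuous_comp f); try (now apply Hf).
  - apply (@continuous_fst R_UniformSpace R_UniformSpace).
  - apply (@continuous_snd R_UniformSpace R_UniformSpace).
Qed.

Lemma CInt_unique (f : R -> C) (a b : R) (l : C) :
  is_CInt f a b l -> CInt f a b = l.
Proof.
  intros H. destruct l as [x y]. unfold CInt. f_equal; apply is_RInt_unique.
  - exact (@is_RInt_fct_extend_fst R_NormedModule R_NormedModule f a b _ H).
  - exact (@is_RInt_fct_extend_snd R_NormedModule R_NormedModule f a b _ H).
Qed.

Lemma CInt_ext (f g : R -> C) (a b : R) : (a <= b)%R ->
  (forall t, (a <= t <= b)%R -> f t = g t) -> CInt f a b = CInt g a b.
Proof.
  intros Hab H. unfold CInt.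
  f_equal; apply RInt_ext; rewrite Rmin_left, Rmax_right by assumption;
    intros t Ht; rewrite H by lra; reflexivity.
Qed.

Lemma CInt_const (c : C) (a b : R) : CInt (fun _ => c) a b = RtoC (b - a) * c.
Proof.
  unfold CInt. rewrite !RInt_const. destruct c as [x y].
  unfold scal; simpl. unfold mult; simpl.
  unfold Cmult, RtoC; simpl. f_equal; ring.
Qed.

Lemma CInt_plus (f g : R -> C) (a b : R) : (a <= b)%R ->
  curve_cont f a b -> curve_cont g a b ->
  CInt (fun t => f t + g t) a b = CInt f a b + CInt g a b.
Proof.
  intros Hab Hf Hg. apply CInt_unique.
  apply (@is_RInt_plus C_R_NormedModule); now apply CInt_correct.
Qed.

Lemma CInt_minus (f g : R -> C) (a b : R) : (a <= b)%R ->
  curve_cont f a b -> curve_cont g a b ->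
  CInt (fun t => f t - g t) a b = CInt f a b - CInt g a b.
Proof.
  intros Hab Hf Hg. apply CInt_unique.
  apply (@is_RInt_minus C_R_NormedModule); now apply CInt_correct.
Qed.

Lemma CInt_scal (c : C) (f : R -> C) (a b : R) : (a <= b)%R -> curve_cont f a b ->
  CInt (fun t => c * f t) a b = c * CInt f a b.
Proof.
  intros Hab Hf. apply CInt_unique.
  assert (H := CInt_correct f a b Hab Hf).
  assert (H1 := @is_RInt_fct_extend_fst R_NormedModule R_NormedModule f a b _ H).
  assert (H2 := @is_RInt_fct_extend_snd R_NormedModule R_NormedModule f a b _ H).
  apply (@is_RInt_fct_extend_pair R_NormedModule R_NormedModule).
  - apply (@is_RInt_minus R_NormedModule);
      apply (@is_RInt_scal R_NormedModule); assumption.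
  - apply (@is_RInt_plus R_NormedModule);
      apply (@is_RInt_scal R_NormedModule); assumption.
Qed.

Lemma CInt_Chasles (f : R -> C) (a m b : R) : (a <= m <= b)%R -> curve_cont f a b ->
  CInt f a m + CInt f m b = CInt f a b.
Proof.
  intros Hm Hf. symmetry. apply CInt_unique.
  apply (@is_RInt_Chasles C_R_NormedModule) with m; apply CInt_correct; try lra;
    intros t Ht; apply Hf; lra.
Qed.

Lemma Cmod_CInt_le (f : R -> C) (a b M : R) : (a <= b)%R -> curve_cont f a b ->
  (forall t, (a <= t <= b)%R -> (Cmod (f t) <= M)%R) ->
  (Cmod (CInt f a b) <= (b - a) * M)%R.
Proof.
  intros Hab Hf HM.
  assert (H := @norm_RInt_le_const C_R_NormedModule f a b (CInt f a b) M Hab).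
  assert (E : forall z : C, @norm R_AbsRing C_R_NormedModule z = Cmod z).
  { intros z. symmetry. apply Cmod_norm. }
  rewrite E in H. apply H.
  - intros t Ht. rewrite E. now apply HM.
  - now apply CInt_correct.
Qed.

(** * Goursat's theorem for rectangles *)

(** The integral of [F] along the boundary of [[a, b] x [c, d]], with the
    integrals over opposite sides combined into one. *)
Definition rect_int (F : C -> C) (a b c d : R) : C :=
  Ci * CInt (fun y => F (b, y) - F (a, y)) c d
  - CInt (fun x => F (x, d) - F (x, c)) a b.

Definition holo_rect (F : C -> C) (a b c d : R) : Prop :=
  forall x y : R, (a <= x <= b)%R -> (c <= y <= d)%R -> holo F (x, y).

Lemma holo_rect_horizontal (F : C -> C) (a b c d y : R) :
  holo_rect F a b c d -> (c <= y <= d)%R -> curve_cont (fun x => F (x, y)) a b.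
Proof.
  intros H Hy x Hx.
  apply (@continuous_comp_2 R_UniformSpace R_UniformSpace R_UniformSpace C_UniformSpace
    (fun x => x) (fun _ => y) (fun x y => F (x, y))).
  - apply continuous_id.
  - apply continuous_const.
  - apply (continuous_ext F). { now intros []. }
    apply holo_ccont, H; assumption.
Qed.

Lemma holo_rect_vertical (F : C -> C) (a b c d x : R) :
  holo_rect F a b c d -> (a <= x <= b)%R -> curve_cont (fun y => F (x, y)) c d.
Proof.
  intros H Hx y Hy.
  apply (@continuous_comp_2 R_UniformSpace R_UniformSpace R_UniformSpace C_UniformSpace
    (fun _ => x) (fun y => y) (fun x y => F (x, y))).
  - apply continuous_const.
  - apply continuous_id.
  - apply (continuous_ext F). { now intros []. }
    apply holo_ccont, H; assumption.
Qed.

Lemma curve_cont_minus (f g : R -> C) (a b : R) :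
  curve_cont f a b -> curve_cont g a b -> curve_cont (fun t => f t - g t) a b.
Proof. intros Hf Hg t Ht. apply Ccontinuous_minus; auto. Qed.

Lemma holo_rect_sub (F : C -> C) (a b c d a' b' c' d' : R) :
  (a <= a')%R -> (b' <= b)%R -> (c <= c')%R -> (d' <= d)%R ->
  holo_rect F a b c d -> holo_rect F a' b' c' d'.
Proof. intros ? ? ? ? H x y Hx Hy. apply H; lra. Qed.

Lemma rect_int_split_x (F : C -> C) (a m b c d : R) :
  (a <= m <= b)%R -> (c <= d)%R -> holo_rect F a b c d ->
  rect_int F a b c d = rect_int F a m c d + rect_int F m b c d.
Proof.
  intros Hm Hc H. unfold rect_int.
  assert (V : forall x, (a <= x <= b)%R -> curve_cont (fun y => F (x, y)) c d)
    by (intros; now apply holo_rect_vertical with a b).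
  rewrite <- (CInt_Chasles _ a m b Hm).
  2:{ apply curve_cont_minus; apply holo_rect_horizontal with c d; auto; lra. }
  rewrite !(CInt_minus _ _ c d Hc) by (apply V; lra). ring.
Qed.

Lemma rect_int_split_y (F : C -> C) (a b c m d : R) :
  (a <= b)%R -> (c <= m <= d)%R -> holo_rect F a b c d ->
  rect_int F a b c d = rect_int F a b c m + rect_int F a b m d.
Proof.
  intros Ha Hm H. unfold rect_int.
  assert (V : forall y, (c <= y <= d)%R -> curve_cont (fun x => F (x, y)) a b)
    by (intros; now apply holo_rect_horizontal with c d).
  rewrite <- (CInt_Chasles _ c m d Hm).
  2:{ apply curve_cont_minus; apply holo_rect_vertical with a b; auto; lra. }
  rewrite !(CInt_minus _ _ a b Ha) by (apply V; lra). ring.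
Qed.

(** For an affine function the boundary integral is zero: the differences of
    values on opposite sides are constant, and the two contributions cancel.
    Hence only the error [K] of the approximation contributes. *)
Lemma rect_int_affine_approx (F : C -> C) (p q : C) (a b c d K : R) :
  (a <= b)%R -> (c <= d)%R -> holo_rect F a b c d ->
  (forall x y, (a <= x <= b)%R -> (c <= y <= d)%R ->
     (Cmod (F (x, y) - (p + (x, y) * q)) <= K)%R) ->
  (Cmod (rect_int F a b c d) <= 2 * K * ((b - a) + (d - c)))%R.
Proof.
  intros Hab Hcd H HK.
  assert (HV : forall x, (a <= x <= b)%R -> curve_cont (fun y => F (x, y)) c d)
    by (intros; now apply holo_rect_vertical with a b).
  assert (HH : forall y, (c <= y <= d)%R -> curve_cont (fun x => F (x, y)) a b)
    by (intros; now apply holo_rect_horizontal with c d).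
  replace (rect_int F a b c d) with
    (Ci * CInt (fun y => F (b, y) - F (a, y) - RtoC (b - a) * q) c d
     - CInt (fun x => F (x, d) - F (x, c) - Ci * RtoC (d - c) * q) a b).
  2:{ unfold rect_int.
      rewrite (CInt_minus (fun y => F (b, y) - F (a, y))),
        (CInt_minus (fun x => F (x, d) - F (x, c)));
        auto.
      - rewrite !CInt_const. ring.
      - apply curve_cont_minus; apply HH; lra.
      - intros t Ht; apply continuous_const.
      - apply curve_cont_minus; apply HV; lra.
      - intros t Ht; apply continuous_const. }
  unfold Cminus at 1. eapply Rle_trans. apply Cmod_triangle.
  rewrite Cmod_opp, Cmod_mult, Cmod_Ci, Rmult_1_l.
  replace (2 * K * (b - a + (d - c)))%R with ((d - c) * (2 * K) + (b - a) * (2 * K))%R by ring.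
  apply Rplus_le_compat; apply Cmod_CInt_le; auto.
  - apply curve_cont_minus; [apply curve_cont_minus; apply HV; lra|].
    intros t Ht; apply continuous_const.
  - intros y Hy.
    replace (F (b, y) - F (a, y) - RtoC (b - a) * q) with
      ((F (b, y) - (p + (b, y) * q)) - (F (a, y) - (p + (a, y) * q))).
    2:{ replace ((b, y) : C) with ((a, y) + RtoC (b - a))
          by (unfold Cplus, RtoC; simpl; f_equal; ring). ring. }
    unfold Cminus at 1. eapply Rle_trans. apply Cmod_triangle. rewrite Cmod_opp.
    generalize (HK b y ltac:(lra) Hy) (HK a y ltac:(lra) Hy). lra.
  - apply curve_cont_minus; [apply curve_cont_minus; apply HH; lra|].
    intros t Ht; apply continuous_const.
  - intros x Hx.
    replace (F (x, d) - F (x, c) - Ci * RtoC (d - c) * q) with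
      ((F (x, d) - (p + (x, d) * q)) - (F (x, c) - (p + (x, c) * q))).
    2:{ replace ((x, d) : C) with ((x, c) + Ci * RtoC (d - c))
          by (unfold Cplus, Cmult, Ci, RtoC; simpl; f_equal; ring). ring. }
    unfold Cminus at 1. eapply Rle_trans. apply Cmod_triangle. rewrite Cmod_opp.
    generalize (HK x d Hx ltac:(lra)) (HK x c Hx ltac:(lra)). lra.
Qed.

Lemma nested_intervals (a b : nat -> R) :
  (forall n, (a n <= a (S n))%R) -> (forall n, (b (S n) <= b n)%R) ->
  (forall n, (a n <= b n)%R) ->
  exists u, forall n, (a n <= u <= b n)%R.
Proof.
  intros Ha Hb Hab.
  assert (Ham : forall n k, (a n <= a (k + n)%nat)%R).
  { intros n k. induction k as [|k IH]; simpl. lra. specialize (Ha (k + n)%nat). lra. }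
  assert (Hbm : forall n k, (b (k + n)%nat <= b n)%R).
  { intros n k. induction k as [|k IH]; simpl. lra. specialize (Hb (k + n)%nat). lra. }
  assert (Hx : forall n m, (a n <= b m)%R).
  { intros n m. specialize (Ham n m). specialize (Hbm m n). specialize (Hab (n + m)%nat).
    rewrite Nat.add_comm in Ham. lra. }
  destruct (completeness (fun x => exists n, x = a n)) as [u [Hu1 Hu2]].
  - exists (b 0%nat). intros x [n ->]. apply Hx.
  - exists (a 0%nat), 0%nat. reflexivity.
  - exists u. intros n. split.
    + apply Hu1. now exists n.
    + apply Hu2. intros x [m ->]. apply Hx.
Qed.

(** If [P] fails on the rectangle, it fails on one of its quarters: the upper
    right one is taken without a test when [P] holds on the other three. *)
Definition bisect_step (P : R -> R -> R -> R -> Prop)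
    (Pdec : forall a b c d, {P a b c d} + {~ P a b c d})
    (r : (R * R) * (R * R)) : (R * R) * (R * R) :=
  let '((a, b), (c, d)) := r in
  let m := ((a + b) / 2)%R in
  let n := ((c + d) / 2)%R in
  if Pdec a m c n then
    if Pdec m b c n then
      if Pdec a m n d then ((m, b), (n, d)) else ((a, m), (n, d))
    else ((m, b), (c, n))
  else ((a, m), (c, n)).

(** If [P] failed on the large rectangle, it would fail on a nested sequence of
    quarters shrinking to a point, contradicting [P] near that point. *)
Lemma rect_bisection (P : R -> R -> R -> R -> Prop)
    (Pdec : forall a b c d, {P a b c d} + {~ P a b c d}) (a0 b0 c0 d0 : R) :
  (a0 <= b0)%R -> (c0 <= d0)%R ->
  (forall a b c d, (a0 <= a <= b)%R -> (b <= b0)%R -> (c0 <= c <= d)%R -> (d <= d0)%R ->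
    let m := ((a + b) / 2)%R in let n := ((c + d) / 2)%R in
    P a m c n -> P m b c n -> P a m n d -> P m b n d -> P a b c d) ->
  (forall u v, (a0 <= u <= b0)%R -> (c0 <= v <= d0)%R ->
    exists e, (0 < e)%R /\ forall a b c d,
      (a0 <= a <= u)%R -> (u <= b <= b0)%R -> (c0 <= c <= v)%R -> (v <= d <= d0)%R ->
      (b - a < e)%R -> (d - c < e)%R -> P a b c d) ->
  P a0 b0 c0 d0.
Proof.
  intros Hab Hcd Hquad Hloc.
  destruct (Pdec a0 b0 c0 d0) as [|HN]; [assumption|exfalso].
  set (r := fun n => Nat.iter n (bisect_step P Pdec) ((a0, b0), (c0, d0))).
  set (a := fun n => fst (fst (r n))). set (b := fun n => snd (fst (r n))).
  set (c := fun n => fst (snd (r n))). set (d := fun n => snd (snd (r n))).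
  assert (Step : forall n, (a0 <= a n <= b n)%R -> (b n <= b0)%R ->
     (c0 <= c n <= d n)%R -> (d n <= d0)%R -> ~ P (a n) (b n) (c n) (d n) ->
     ~ P (a (S n)) (b (S n)) (c (S n)) (d (S n)) /\
     (a n <= a (S n))%R /\ (b (S n) <= b n)%R /\ (c n <= c (S n))%R /\ (d (S n) <= d n)%R /\
     (b (S n) - a (S n) = (b n - a n) / 2)%R /\ (d (S n) - c (S n) = (d n - c n) / 2)%R).
  { intros n. unfold a, b, c, d. simpl (r (S n)). change (Nat.iter n _ _) with (r n).
    destruct (r n) as [[an bn] [cn dn]]. simpl. intros H1 H2 H3 H4 HP.
    assert (HQ := Hquad an bn cn dn H1 H2 H3 H4).
    destruct (Pdec an _ cn _) as [Q1|]; [|simpl; repeat split; auto; lra].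
    destruct (Pdec _ bn cn _) as [Q2|]; [|simpl; repeat split; auto; lra].
    destruct (Pdec an _ _ dn) as [Q3|]; [|simpl; repeat split; auto; lra].
    simpl; repeat split; try lra. intros Q4. apply HP, HQ; assumption. }
  assert (Inv : forall n, (a0 <= a n <= b n)%R /\ (b n <= b0)%R /\
     (c0 <= c n <= d n)%R /\ (d n <= d0)%R /\ ~ P (a n) (b n) (c n) (d n)).
  { induction n as [|n (I1 & I2 & I3 & I4 & I5)].
    - unfold a, b, c, d; simpl. repeat split; auto; lra.
    - destruct (Step n I1 I2 I3 I4 I5) as (S1 & S2 & S3 & S4 & S5 & S6 & S7).
      repeat split; auto; lra. }
  assert (Step' : forall n, (a n <= a (S n))%R /\ (b (S n) <= b n)%R /\
     (c n <= c (S n))%R /\ (d (S n) <= d n)%R /\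
     (b (S n) - a (S n) = (b n - a n) / 2)%R /\ (d (S n) - c (S n) = (d n - c n) / 2)%R).
  { intros n. destruct (Inv n) as (I1 & I2 & I3 & I4 & I5). now apply Step. }
  destruct (nested_intervals a b) as [u Hu]; try (intros n; apply Step' || apply Inv).
  destruct (nested_intervals c d) as [v Hv]; try (intros n; apply Step' || apply Inv).
  destruct (Hloc u v) as [e [He HP]]; [apply (Hu 0%nat) | apply (Hv 0%nat) |].
  assert (Hw : forall n, (b n - a n = (b0 - a0) * (1 / 2) ^ n)%R /\
                         (d n - c n = (d0 - c0) * (1 / 2) ^ n)%R).
  { induction n as [|n [W1 W2]].
    - unfold a, b, c, d; simpl. lra.
    - destruct (Step' n) as (_ & _ & _ & _ & S6 & S7). simpl. lra. }
  destruct (pow_lt_1_zero (1 / 2) ltac:(rewrite Rabs_right; lra)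
    (e / (b0 - a0 + (d0 - c0) + 1)))%R as [N HN'].
  { apply Rdiv_lt_0_compat; lra. }
  specialize (HN' N (le_n N)). rewrite Rabs_right in HN'.
  2:{ apply Rle_ge, pow_le; lra. }
  apply Rlt_div_r in HN'; [|lra].
  assert (Hp : (0 < (1 / 2) ^ N)%R) by (apply pow_lt; lra).
  destruct (Inv N) as (I1 & I2 & I3 & I4 & I5). destruct (Hw N) as [W1 W2].
  destruct (Hu N). destruct (Hv N).
  apply I5, HP; try lra; nra.
Qed.

(** The boundary integral is additive under quartering, and so is the bound
    [2 e (width + height) ^ 2], since each quarter carries a fourth of it.
    By bisection it suffices to have the bound on small rectangles around a
    point, where [F] is affine up to [e] times the diameter. *)
Theorem goursat_rectangle (F : C -> C) (a b c d : R) :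
  (a <= b)%R -> (c <= d)%R -> holo_rect F a b c d -> rect_int F a b c d = 0.
Proof.
  intros Hab Hcd HF. apply Cmod_eq_0.
  set (L := ((b - a) + (d - c))%R).
  apply Rle_antisym; [|apply Cmod_ge_0].
  apply le_epsilon. intros e0 He0. rewrite Rplus_0_l.
  (* Chosen so that [2 e L ^ 2 <= e0]. *)
  set (e := (e0 / (2 * (L * L + 1)))%R).
  assert (HL : (0 <= L)%R) by (unfold L; lra).
  assert (HL2 : (0 <= L * L)%R) by (apply Rmult_le_pos; assumption).
  assert (He : (0 < e)%R) by (apply Rdiv_lt_0_compat; lra).
  set (Q := fun a b c d =>
    (Cmod (rect_int F a b c d) <= 2 * e * ((b - a) + (d - c)) ^ 2)%R).
  assert (HQ : Q a b c d).
  { apply rect_bisection; auto.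
    - intros; apply Rle_dec.
    - intros a1 b1 c1 d1 Ha1 Hb1 Hc1 Hd1 m n. unfold Q.
      assert (Hm : (a1 <= m <= b1)%R) by (unfold m; lra).
      assert (Hn : (c1 <= n <= d1)%R) by (unfold n; lra).
      assert (HF1 : holo_rect F a1 b1 c1 d1) by (apply holo_rect_sub with a b c d; auto; lra).
      rewrite (rect_int_split_x F a1 m b1 c1 d1) by (auto; lra).
      rewrite (rect_int_split_y F a1 m c1 n d1), (rect_int_split_y F m b1 c1 n d1);
        auto; try lra; try (apply holo_rect_sub with a1 b1 c1 d1; auto; lra).
      intros H1 H2 H3 H4.
      eapply Rle_trans. apply Cmod_triangle.
      eapply Rle_trans. apply Rplus_le_compat; apply Cmod_triangle.
      unfold m, n in *. lra.
    - intros u v Hu Hv.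
      destruct (HF u v Hu Hv) as [l Hl].
      destruct (proj1 (is_C_derive_Cmod F (u, v) l) Hl e He) as [dl [Hdl Hd]].
      exists (dl / 2)%R. split. lra.
      intros a1 b1 c1 d1 Ha1 Hb1 Hc1 Hd1 Hw Hh. unfold Q.
      replace (2 * e * (b1 - a1 + (d1 - c1)) ^ 2)%R
        with (2 * (e * (b1 - a1 + (d1 - c1))) * ((b1 - a1) + (d1 - c1)))%R by ring.
      apply rect_int_affine_approx with (F (u, v) - (u, v) * l) l; try lra.
      + apply holo_rect_sub with a b c d; auto; lra.
      + intros x y Hx Hy.
        assert (Hs : (Cmod ((x, y) - (u, v)) <= (b1 - a1) + (d1 - c1))%R).
        { unfold Cminus, Cplus, Copp; simpl. eapply Rle_trans. apply Cmod_le_sum.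
          apply Rplus_le_compat; apply Rabs_le; lra. }
        replace (F (x, y) - (F (u, v) - (u, v) * l + (x, y) * l))
          with (F (x, y) - F (u, v) - ((x, y) - (u, v)) * l) by ring.
        eapply Rle_trans. apply Hd. lra.
        apply Rmult_le_compat_l; lra. }
  unfold Q in HQ. fold L in HQ. eapply Rle_trans. exact HQ.
  unfold e. replace (2 * (e0 / (2 * (L * L + 1))) * L ^ 2)%R
    with (e0 * (L * L) / (L * L + 1))%R by (field; lra).
  apply Rle_div_l; [lra|]. apply Rmult_le_compat_l; lra.
Qed.

(** * Integrals over circles centred at the origin *)

Definition circle (r t : R) : C := (r * cos t, r * sin t)%R.

(** Integration is with respect to the angle; this is [1 / i] times the contour
    integral of [f z / z]. *)
Definition circ_int (f : C -> C) (r : R) : C :=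
  CInt (fun t => f (circle r t)) 0 (2 * PI).

Definition circ_cont (f : C -> C) (r : R) : Prop :=
  forall z : C, Cmod z = r -> ccont f z.

Lemma cexp_circle (x y : R) : cexp (x, y) = circle (exp x) y.
Proof. reflexivity. Qed.

Lemma Cmod_circle (r t : R) : (0 < r)%R -> Cmod (circle r t) = r.
Proof.
  intros Hr. rewrite <- (exp_ln r Hr) at 1.
  rewrite <- cexp_circle, Cmod_cexp. simpl. now apply exp_ln.
Qed.

Lemma two_PI_pos : (0 < 2 * PI)%R.
Proof. generalize PI_RGT_0. lra. Qed.

Lemma continuous_circle (p : R * R) :
  @continuous (prod_UniformSpace R_UniformSpace R_UniformSpace) C_UniformSpace
    (fun q => circle (fst q) (snd q)) p.
Proof.
  apply (@continuous_ext _ C_UniformSpace (fun q : R * R =>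
    RtoC (fst q) * cexp (0%R, snd q))).
  { intros [r t]. simpl. unfold cexp, circle, Cmult, RtoC; simpl.
    rewrite exp_0. f_equal; ring. }
  assert (HC : forall g : R * R -> R, @continuous _ R_UniformSpace g p ->
    forall c : R -> C, (forall x, @continuous R_UniformSpace C_UniformSpace c x) ->
    @continuous _ C_UniformSpace (fun q => c (g q)) p).
  { intros g Hg c Hc. apply (@continuous_comp _ R_UniformSpace C_UniformSpace g c); auto. }
  assert (HP : forall (x y : R -> R) t, @continuous R_UniformSpace R_UniformSpace x t ->
    @continuous R_UniformSpace R_UniformSpace y t ->
    @continuous R_UniformSpace C_UniformSpace (fun t => (x t, y t)) t).
  { intros x y t Hx Hy.
    apply (@continuous_comp_2 R_UniformSpace R_UniformSpace R_UniformSpace C_UniformSpace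
      x y pair t Hx Hy).
    apply (continuous_ext (fun z : R * R => z)). now intros [].
    apply continuous_id. }
  apply Ccontinuous_mult.
  - apply (HC fst). apply continuous_fst. intros x. apply HP.
    apply continuous_id. apply continuous_const.
  - apply (HC snd) with (c := fun y => cexp (0%R, y)). apply continuous_snd.
    intros y. apply (@continuous_comp R_UniformSpace C_UniformSpace C_UniformSpace).
    apply HP. apply continuous_const. apply continuous_id.
    apply holo_ccont, holo_cexp.
Qed.

Lemma continuous_circ (f : C -> C) (r t : R) : ccont f (circle r t) ->
  @continuous (prod_UniformSpace R_UniformSpace R_UniformSpace) C_UniformSpace
    (fun q => f (circle (fst q) (snd q))) (r, t).
Proof.
  intros H.
  apply (@continuous_comp (prod_UniformSpace R_UniformSpace R_UniformSpace)
    C_UniformSpace C_UniformSpace (fun q => circle (fst q) (snd q)) f).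
  apply continuous_circle. exact H.
Qed.

Lemma circ_cont_curve (f : C -> C) (r a b : R) : (0 < r)%R -> circ_cont f r ->
  curve_cont (fun t => f (circle r t)) a b.
Proof.
  intros Hr Hf t _.
  apply (@continuous_comp_2 R_UniformSpace R_UniformSpace R_UniformSpace C_UniformSpace
    (fun _ => r) (fun t => t) (fun r t => f (circle r t))).
  - apply continuous_const.
  - apply continuous_id.
  - apply continuous_circ. apply Hf. now apply Cmod_circle.
Qed.

Lemma circ_int_ext (f g : C -> C) (r : R) : (0 < r)%R ->
  (forall z, Cmod z = r -> f z = g z) -> circ_int f r = circ_int g r.
Proof.
  intros Hr H. apply CInt_ext. generalize two_PI_pos; lra.
  intros t _. apply H. now apply Cmod_circle.
Qed.

Lemma circ_int_plus (f g : C -> C) (r : R) : (0 < r)%R ->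
  circ_cont f r -> circ_cont g r ->
  circ_int (fun z => f z + g z) r = circ_int f r + circ_int g r.
Proof.
  intros Hr Hf Hg. unfold circ_int.
  apply (CInt_plus (fun t => f (circle r t)) (fun t => g (circle r t))).
  generalize two_PI_pos; lra. all: now apply circ_cont_curve.
Qed.

Lemma circ_int_minus (f g : C -> C) (r : R) : (0 < r)%R ->
  circ_cont f r -> circ_cont g r ->
  circ_int (fun z => f z - g z) r = circ_int f r - circ_int g r.
Proof.
  intros Hr Hf Hg. unfold circ_int.
  apply (CInt_minus (fun t => f (circle r t)) (fun t => g (circle r t))).
  generalize two_PI_pos; lra. all: now apply circ_cont_curve.
Qed.

Lemma circ_int_scal (c : C) (f : C -> C) (r : R) : (0 < r)%R -> circ_cont f r ->
  circ_int (fun z => c * f z) r = c * circ_int f r.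
Proof.
  intros Hr Hf. unfold circ_int.
  apply (CInt_scal c (fun t => f (circle r t))).
  generalize two_PI_pos; lra. now apply circ_cont_curve.
Qed.

Lemma circ_cont_mult (f g : C -> C) (r : R) :
  circ_cont f r -> circ_cont g r -> circ_cont (fun z => f z * g z) r.
Proof. intros Hf Hg z Hz. apply Ccontinuous_mult; auto. Qed.

Lemma circ_cont_plus (f g : C -> C) (r : R) :
  circ_cont f r -> circ_cont g r -> circ_cont (fun z => f z + g z) r.
Proof. intros Hf Hg z Hz. apply Ccontinuous_plus; auto. Qed.

(** Goursat for [f] in the logarithmic coordinate: the integrals over the
    horizontal sides cancel by periodicity, and those over the vertical sides
    are the two circular integrals. *)
Lemma circ_int_holo_const (f : C -> C) (r1 r2 : R) : (0 < r1 <= r2)%R ->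
  (forall z, (r1 <= Cmod z <= r2)%R -> holo f z) ->
  circ_int f r1 = circ_int f r2.
Proof.
  intros Hr Hf.
  assert (HF : holo_rect (fun s => f (cexp s)) (ln r1) (ln r2) 0 (2 * PI)).
  { intros x y Hx _. apply holo_comp; [|apply holo_cexp].
    apply Hf. rewrite Cmod_cexp. simpl.
    rewrite <- (exp_ln r1), <- (exp_ln r2) by lra.
    destruct Hx as [[Hx1| ->] [Hx2| ->]]; split;
      try apply Rle_refl; apply Rlt_le, exp_increasing; assumption. }
  assert (Hln : (ln r1 <= ln r2)%R) by (apply ln_le; lra).
  assert (Hpi := two_PI_pos).
  assert (HG := goursat_rectangle _ _ _ _ _ Hln (Rlt_le _ _ Hpi) HF).
  unfold rect_int in HG.
  rewrite (CInt_ext _ (fun _ => 0) (ln r1) (ln r2) Hln) in HG.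
  2:{ intros x _. rewrite !cexp_circle. unfold circle.
      rewrite cos_2PI, sin_2PI, cos_0, sin_0. ring. }
  rewrite CInt_const in HG.
  rewrite CInt_minus in HG; try lra.
  2,3: apply (holo_rect_vertical _ _ _ _ _ _ HF); lra.
  rewrite (CInt_ext (fun t => f (cexp (ln r2, t))) (fun t => f (circle r2 t))) in HG; try lra.
  2:{ intros t _. rewrite cexp_circle, exp_ln by lra. reflexivity. }
  rewrite (CInt_ext (fun t => f (cexp (ln r1, t))) (fun t => f (circle r1 t))) in HG; try lra.
  2:{ intros t _. rewrite cexp_circle, exp_ln by lra. reflexivity. }
  fold (circ_int f r1) (circ_int f r2) in HG.
  replace (circ_int f r2) with (circ_int f r1 - Ci * (Ci * (circ_int f r2 - circ_int f r1)
     - RtoC (ln r2 - ln r1) * 0)).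
  { rewrite HG. ring. }
  replace (Ci * (Ci * (circ_int f r2 - circ_int f r1) - RtoC (ln r2 - ln r1) * 0))
    with ((Ci * Ci) * (circ_int f r2 - circ_int f r1)) by ring.
  replace (Ci * Ci) with (- RtoC 1)
    by (unfold Ci, Cmult, Copp, RtoC; simpl; f_equal; ring).
  ring.
Qed.

(** Compactness of [[a, b]] makes the continuity of [h] at the points [(r, t)]
    uniform in [t]. *)
Lemma tube_continuity (h : R * R -> C) (r a b : R) :
  (forall t, (a <= t <= b)%R ->
     @continuous (prod_UniformSpace R_UniformSpace R_UniformSpace) C_UniformSpace h (r, t)) ->
  forall e, (0 < e)%R -> exists d, (0 < d)%R /\ forall r' t,
    (Rabs (r' - r) < d)%R -> (a <= t <= b)%R -> (Cmod (h (r', t) - h (r, t)) <= e)%R.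
Proof.
  intros Hh e He.
  assert (HD : forall t, exists d : posreal, (a <= t <= b)%R -> forall r' x,
    (Rabs (r' - r) < d)%R -> (Rabs (x - t) < d)%R ->
    (Cmod (h (r', x) - h (r, t)) < e / 2)%R).
  { intros t. destruct (classic (a <= t <= b)%R) as [Ht|Ht].
    - destruct (proj1 (continuous_Cmod h (r, t)) (Hh t Ht) (e / 2)%R) as [d Hd]. lra.
      exists d. intros _ r' x Hr Hx. apply Hd. split; assumption.
    - exists (mkposreal 1 Rlt_0_1). tauto. }
  set (D := fun t => proj1_sig (constructive_indefinite_description _ (HD t))).
  assert (HD' : forall t, (a <= t <= b)%R -> forall r' x,
    (Rabs (r' - r) < D t)%R -> (Rabs (x - t) < D t)%R ->
    (Cmod (h (r', x) - h (r, t)) < e / 2)%R).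
  { intros t. exact (proj2_sig (constructive_indefinite_description _ (HD t))). }
  destruct (compactness_value_1d a b D) as [d Hd].
  exists d. split. apply cond_pos. intros r' x Hr Hx.
  destruct (NNPP _ (Hd x Hx)) as [t (Ht & Hxt & Hdt)].
  replace (h (r', x) - h (r, x)) with ((h (r', x) - h (r, t)) - (h (r, x) - h (r, t))) by ring.
  unfold Cminus at 1. eapply Rle_trans. apply Cmod_triangle. rewrite Cmod_opp.
  assert (H1 := HD' t Ht r' x ltac:(lra) Hxt).
  assert (H2 := HD' t Ht r x ltac:(rewrite Rminus_diag, Rabs_R0; apply cond_pos) Hxt).
  lra.
Qed.

(** Constancy holds on each side of the circle of radius [r], and the values on
    the two sides agree because both tend to the integral over that circle. *)
Lemma circ_int_const_across (f : C -> C) (r1 r r2 : R) : (0 < r1 < r)%R -> (r < r2)%R ->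
  (forall z, (r1 <= Cmod z <= r2)%R -> ccont f z) ->
  (forall z, (r1 <= Cmod z <= r2)%R -> Cmod z <> r -> holo f z) ->
  circ_int f r1 = circ_int f r2.
Proof.
  intros Hr1 Hr2 Hc Hf.
  assert (Hpi := two_PI_pos).
  assert (HE : forall e, (0 < e)%R -> (Cmod (circ_int f r1 - circ_int f r2) <= 0 + e)%R).
  { intros e He.
    destruct (tube_continuity (fun q => f (circle (fst q) (snd q))) r 0 (2 * PI)) with
      (e := (e / (2 * (2 * PI)))%R) as [d [Hd H]].
    { intros t _. apply continuous_circ, Hc. rewrite Cmod_circle by lra. lra. }
    { apply Rdiv_lt_0_compat; lra. }
    assert (Hclose : forall r', (r1 <= r' <= r2)%R -> (Rabs (r' - r) < d)%R ->
      (Cmod (circ_int f r' - circ_int f r) <= e / 2)%R).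
    { intros r' Hr' Hd'.
      replace (e / 2)%R with ((2 * PI - 0) * (e / (2 * (2 * PI))))%R by (field; lra).
      unfold circ_int. rewrite <- CInt_minus; try lra.
      2,3: apply circ_cont_curve; [lra|]; intros z Hz; apply Hc; lra.
      apply Cmod_CInt_le. lra.
      - apply curve_cont_minus; apply circ_cont_curve; try lra; intros z Hz; apply Hc; lra.
      - intros t Ht. apply (H r' t Hd' Ht). }
    set (s1 := Rmax r1 (r - d / 2)). set (s2 := Rmin r2 (r + d / 2)).
    assert (S1 : (r1 <= s1 < r)%R /\ (r - d / 2 <= s1)%R).
    { unfold s1. split; [split|]. apply Rmax_l. apply Rmax_lub_lt; lra. apply Rmax_r. }
    assert (S2 : (r < s2 <= r2)%R /\ (s2 <= r + d / 2)%R).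
    { unfold s2. split; [split|]. apply Rmin_glb_lt; lra. apply Rmin_l. apply Rmin_r. }
    rewrite (circ_int_holo_const f r1 s1), <- (circ_int_holo_const f s2 r2); try lra;
      try (intros z Hz; apply Hf; lra).
    replace (circ_int f s1 - circ_int f s2) with
      ((circ_int f s1 - circ_int f r) - (circ_int f s2 - circ_int f r)) by ring.
    unfold Cminus at 1. eapply Rle_trans. apply Cmod_triangle. rewrite Cmod_opp.
    assert (H1 := Hclose s1 ltac:(lra) ltac:(apply Rabs_def1; lra)).
    assert (H2 := Hclose s2 ltac:(lra) ltac:(apply Rabs_def1; lra)).
    lra. }
  assert (H0 : Cmod (circ_int f r1 - circ_int f r2) = 0%R).
  { apply Rle_antisym; [|apply Cmod_ge_0]. now apply le_epsilon. }
  apply Cmod_eq_0 in H0.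
  replace (circ_int f r1) with (circ_int f r1 - circ_int f r2 + circ_int f r2) by ring.
  rewrite H0. ring.
Qed.

Lemma holo_inv_pow (n : nat) (z : C) : z <> 0 -> holo (fun y => / y ^ n) z.
Proof.
  intros Hz. apply (holo_comp Cinv (fun y => y ^ n)).
  - apply holo_inv. now apply Cpow_nz.
  - apply holo_pow.
Qed.

Lemma Cmod_pos_neq_0 (z : C) (r : R) : (0 < r)%R -> Cmod z = r -> z <> 0.
Proof. intros Hr Hz. apply Cmod_gt_0. lra. Qed.

Lemma circ_cont_const (c : C) (r : R) : circ_cont (fun _ => c) r.
Proof. intros z _. apply continuous_const. Qed.

Lemma circ_cont_pow (n : nat) (r : R) : circ_cont (fun z => z ^ n) r.
Proof. intros z _. apply holo_ccont, holo_pow. Qed.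

Lemma circ_cont_inv_pow (n : nat) (r : R) : (0 < r)%R -> circ_cont (fun z => / z ^ n) r.
Proof.
  intros Hr z Hz. apply holo_ccont, holo_inv_pow. now apply Cmod_pos_neq_0 with r.
Qed.

Lemma pow_2_inj (p q : nat) : (2 ^ p = 2 ^ q)%R -> p = q.
Proof.
  intros H. destruct (Nat.lt_trichotomy p q) as [L|[E|L]]; auto;
    apply (Rlt_pow 2) in L; lra.
Qed.

(** The integral does not depend on [r], yet doubling [r] multiplies it by
    [2 ^ (p - q)], which is not 1. *)
Lemma circ_int_pow_quot_0 (p q : nat) (r : R) : (0 < r)%R -> p <> q ->
  circ_int (fun z => z ^ p * / z ^ q) r = 0.
Proof.
  intros Hr Hpq.
  set (f := fun z : C => z ^ p * / z ^ q).
  assert (Hc : forall s, (0 < s)%R -> circ_cont f s).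
  { intros s Hs. apply circ_cont_mult. apply circ_cont_pow. now apply circ_cont_inv_pow. }
  assert (H1 : circ_int f r = circ_int f (2 * r)%R).
  { apply circ_int_holo_const. lra. intros z Hz.
    assert (Hz0 : z <> 0) by (apply Cmod_gt_0; lra).
    apply holo_mult. apply holo_pow. now apply holo_inv_pow. }
  assert (H2 : circ_int f (2 * r)%R = RtoC (2 ^ p * / 2 ^ q) * circ_int f r).
  { rewrite <- circ_int_scal by auto. apply CInt_ext. generalize two_PI_pos; lra.
    intros t _. replace (circle (2 * r) t) with (RtoC 2 * circle r t)
      by (unfold circle, Cmult, RtoC; simpl; f_equal; ring).
    assert (Hz0 : circle r t <> 0) by (apply Cmod_gt_0; now rewrite Cmod_circle).
    assert (H20 : RtoC 2 <> 0) by (intros E; apply RtoC_inj in E; lra).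
    unfold f. rewrite !Cpow_mult_l, RtoC_mult, RtoC_inv, !RtoC_pow
      by (apply pow_nonzero; lra).
    field. split; now apply Cpow_nz. }
  assert (Hk : RtoC (1 - 2 ^ p * / 2 ^ q) <> 0).
  { intros E. apply RtoC_inj in E. apply Hpq, pow_2_inj.
    assert (0 < 2 ^ q)%R by (apply pow_lt; lra).
    apply Rmult_eq_reg_r with (/ 2 ^ q)%R; [|apply Rinv_neq_0_compat; lra].
    rewrite Rinv_r by lra. lra. }
  assert (H3 : RtoC (1 - 2 ^ p * / 2 ^ q) * circ_int f r = 0).
  { rewrite RtoC_minus.
    replace ((1 - RtoC (2 ^ p * / 2 ^ q)) * circ_int f r)
      with (circ_int f r - RtoC (2 ^ p * / 2 ^ q) * circ_int f r) by ring.
    rewrite <- H2, <- H1. ring. }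
  destruct (Ceq_dec (circ_int f r) 0) as [E|E]; [exact E|].
  now destruct (Cmult_neq_0 _ _ Hk E).
Qed.

Lemma circ_int_const (c : C) (r : R) : circ_int (fun _ => c) r = RtoC (2 * PI) * c.
Proof. unfold circ_int. rewrite CInt_const. now rewrite Rminus_0_r. Qed.

(** * Series *)

Notation is_Cseries := (@is_series C_AbsRing C_NormedModule).

Lemma is_Cseries_unique (u : nat -> C) (l m : C) :
  is_Cseries u l -> is_Cseries u m -> l = m.
Proof.
  intros Hl Hm.
  exact (@filterlim_locally_unique nat C_AbsRing C_NormedModule eventually _ _ l m Hl Hm).
Qed.

Lemma is_Cseries_Cmod (u : nat -> C) (l : C) :
  is_Cseries u l <-> forall e, (0 < e)%R -> exists N, forall n, (N <= n)%nat ->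
    (Cmod (sum_n u n - l) < e)%R.
Proof.
  split.
  - intros H e He. apply (H (fun v => Cmod (v - l) < e)%R).
    apply locally_Cmod. exists e. auto.
  - intros H P HP. apply locally_Cmod in HP. destruct HP as [d [Hd HP]].
    destruct (H d Hd) as [N HN]. exists N. intros n Hn. apply HP, HN, Hn.
Qed.

Lemma is_Cseries_geom (u : nat -> C) (l : C) (A q : R) : (0 <= q < 1)%R ->
  (forall n, (Cmod (l - sum_n u n) <= A * q ^ n)%R) -> is_Cseries u l.
Proof.
  intros Hq H. apply is_Cseries_Cmod. intros e He.
  assert (HA : (0 <= A)%R).
  { generalize (H 0%nat) (Cmod_ge_0 (l - sum_n u 0)). simpl. lra. }
  destruct (pow_lt_1_zero q ltac:(rewrite Rabs_right; lra) (e / (A + 1))%R) as [N HN].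
  { apply Rdiv_lt_0_compat; lra. }
  exists N. intros n Hn. specialize (HN n Hn).
  assert (Hp : (0 <= q ^ n)%R) by (apply pow_le; lra).
  rewrite Rabs_right in HN by (apply Rle_ge; exact Hp).
  apply Rlt_div_r in HN; [|lra].
  rewrite Cmod_minus_sym. specialize (H n). nra.
Qed.

Lemma Csum_S (u : nat -> C) (n : nat) : sum_n u (S n) = sum_n u n + u (S n).
Proof. exact (@sum_Sn C_AbelianMonoid u n). Qed.

Lemma Csum_O (u : nat -> C) : sum_n u 0 = u 0%nat.
Proof. exact (@sum_O C_AbelianMonoid u). Qed.

Lemma is_Cseries_bounded (u : nat -> C) (l : C) : is_Cseries u l ->
  exists A, forall k, (Cmod (u k) <= A)%R.
Proof.
  intros H. destruct (proj1 (is_Cseries_Cmod u l) H 1%R Rlt_0_1) as [N HN].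
  assert (HF : forall M, exists A, forall k, (k <= M)%nat -> (Cmod (u k) <= A)%R).
  { induction M as [|M [A HA]].
    - exists (Cmod (u 0%nat)). intros k Hk. replace k with 0%nat by lia. lra.
    - exists (Rmax A (Cmod (u (S M)))). intros k Hk.
      destruct (Nat.eq_dec k (S M)) as [->|Hne]. apply Rmax_r.
      eapply Rle_trans; [apply HA; lia | apply Rmax_l]. }
  destruct (HF N) as [A HA]. exists (Rmax A 2). intros k.
  destruct (le_lt_dec k N) as [Hk|Hk].
  - eapply Rle_trans; [apply HA, Hk | apply Rmax_l].
  - destruct k as [|k]; [lia|]. eapply Rle_trans; [|apply Rmax_r].
    replace (u (S k)) with ((sum_n u (S k) - l) - (sum_n u k - l))
      by (rewrite Csum_S; ring).
    unfold Cminus at 1. eapply Rle_trans. apply Cmod_triangle. rewrite Cmod_opp.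
    generalize (HN (S k) ltac:(lia)) (HN k ltac:(lia)). lra.
Qed.

Lemma Cseries_tail (u : nat -> C) (l : C) (A q : R) : (0 <= q < 1)%R ->
  is_Cseries u l -> (forall k, (Cmod (u k) <= A * q ^ k)%R) ->
  forall n, (Cmod (l - sum_n u n) <= A * q ^ S n / (1 - q))%R.
Proof.
  intros Hq H HA n.
  assert (HA0 : (0 <= A)%R) by (generalize (HA 0%nat) (Cmod_ge_0 (u 0%nat)); simpl; lra).
  (* Partial tails sum to at most a finite geometric sum. *)
  assert (HP : forall m, (Cmod (sum_n u (m + n) - sum_n u n)
                 <= A * q ^ S n * (1 - q ^ m) / (1 - q))%R).
  { induction m as [|m IH].
    - simpl (0 + n)%nat. replace (sum_n u n - sum_n u n) with (RtoC 0) by ring.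
      rewrite Cmod_0. simpl. right. field. lra.
    - simpl (S m + n)%nat. rewrite Csum_S.
      replace (sum_n u (m + n) + u (S (m + n)) - sum_n u n)
        with ((sum_n u (m + n) - sum_n u n) + u (S (m + n))) by ring.
      eapply Rle_trans. apply Cmod_triangle.
      eapply Rle_trans. apply Rplus_le_compat; [apply IH | apply HA].
      right. simpl. rewrite pow_add. field. lra. }
  apply le_epsilon. intros e He.
  destruct (proj1 (is_Cseries_Cmod u l) H e He) as [N HN].
  specialize (HN (N + n)%nat ltac:(lia)). rewrite Cmod_minus_sym in HN.
  replace (l - sum_n u n) with ((l - sum_n u (N + n)) + (sum_n u (N + n) - sum_n u n)) by ring.
  eapply Rle_trans. apply Cmod_triangle. rewrite Rplus_comm.
  apply Rplus_le_compat; [|lra].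
  eapply Rle_trans. apply HP. unfold Rdiv. apply Rmult_le_compat_r.
  { apply Rlt_le, Rinv_0_lt_compat. lra. }
  rewrite <- Rmult_1_r. apply Rmult_le_compat_l.
  { apply Rmult_le_pos; [lra|]. apply pow_le; lra. }
  assert (0 <= q ^ N)%R by (apply pow_le; lra). lra.
Qed.

Lemma is_Cseries_single (u : nat -> C) (l : C) (j : nat) : is_Cseries u l ->
  (forall k, k <> j -> u k = 0) -> l = u j.
Proof.
  intros H Hu. apply (is_Cseries_unique u l (u j) H).
  assert (H0 : forall n, (n < j)%nat -> @eq C (sum_n u n) 0).
  { induction n as [|n IH]; intros Hn.
    - rewrite Csum_O. apply Hu. lia.
    - rewrite Csum_S, IH, Hu by lia. ring. }
  assert (H1 : forall n, @eq C (sum_n u (n + j)) (u j)).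
  { induction n as [|n IH].
    - simpl. destruct j as [|j]. apply Csum_O.
      rewrite Csum_S, H0 by lia. ring.
    - simpl (S n + j)%nat. rewrite Csum_S, IH, (Hu (S (n + j))) by lia. ring. }
  apply is_Cseries_Cmod. intros e He. exists j. intros n Hn.
  replace n with ((n - j) + j)%nat by lia. rewrite H1.
  replace (u j - u j) with (RtoC 0) by ring. now rewrite Cmod_0.
Qed.

Lemma circ_int_sum (u : nat -> C -> C) (r : R) (n : nat) : (0 < r)%R ->
  (forall k, circ_cont (u k) r) ->
  circ_cont (fun z => sum_n (fun k => u k z) n) r /\
  circ_int (fun z => sum_n (fun k => u k z) n) r = sum_n (fun k => circ_int (u k) r) n.
Proof.
  intros Hr Hu. induction n as [|n [IH1 IH2]].
  - split.
    + intros z Hz. apply (continuous_ext (u 0%nat)).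
      intros y; symmetry; apply Csum_O. now apply Hu.
    + rewrite Csum_O. apply circ_int_ext; auto. intros; apply Csum_O.
  - split.
    + intros z Hz.
      apply (continuous_ext (fun y => sum_n (fun k => u k y) n + u (S n) y)).
      intros y; symmetry; apply Csum_S.
      apply circ_cont_plus with r; auto.
    + rewrite Csum_S, <- IH2, <- circ_int_plus by auto.
      apply circ_int_ext; auto. intros; apply Csum_S.
Qed.

(** Term-by-term integration of a series that converges at a geometric rate,
    uniformly on the circle. *)
Lemma circ_int_series (u : nat -> C -> C) (g : C -> C) (r A q : R) :
  (0 < r)%R -> (0 <= q < 1)%R -> (forall k, circ_cont (u k) r) -> circ_cont g r ->
  (forall n t, (0 <= t <= 2 * PI)%R ->
     (Cmod (g (circle r t) - sum_n (fun k => u k (circle r t)) n) <= A * q ^ n)%R) ->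
  is_Cseries (fun k => circ_int (u k) r) (circ_int g r).
Proof.
  intros Hr Hq Hu Hg H.
  apply is_Cseries_geom with (A := (2 * PI * A)%R) (q := q); auto. intros n.
  destruct (circ_int_sum u r n Hr Hu) as [S1 S2].
  rewrite <- S2, <- circ_int_minus by auto.
  replace (2 * PI * A * q ^ n)%R with ((2 * PI - 0) * (A * q ^ n))%R by ring.
  apply Cmod_CInt_le. generalize two_PI_pos; lra.
  - apply curve_cont_minus; [exact (circ_cont_curve _ r _ _ Hr Hg)|].
    exact (circ_cont_curve _ r _ _ Hr S1).
  - intros t Ht. now apply H.
Qed.

Lemma circ_bounded (f : C -> C) (r : R) : (0 < r)%R -> circ_cont f r ->
  exists A, (0 <= A)%R /\
    forall t, (0 <= t <= 2 * PI)%R -> (Cmod (f (circle r t)) <= A)%R.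
Proof.
  intros Hr Hf.
  destruct (continuity_ab_maj (fun t => Cmod (f (circle r t))) 0 (2 * PI)) as [m [Hm _]].
  - generalize two_PI_pos; lra.
  - intros t Ht. apply continuity_pt_filterlim.
    apply (continuous_ext (fun t => @norm R_AbsRing C_R_NormedModule (f (circle r t)))).
    { intros x. symmetry. apply Cmod_norm. }
    apply (@continuous_comp R_UniformSpace C_R_NormedModule R_UniformSpace
      (fun t => f (circle r t)) norm).
    + now apply (circ_cont_curve f r 0 (2 * PI)).
    + apply filterlim_norm.
  - exists (Cmod (f (circle r m))). split. apply Cmod_ge_0. exact Hm.
Qed.

(** * Cauchy's formula on an annulus and Laurent expansion *)

(** With respect to the angle, [y / (y - z)] plays the role that [1 / (y - z)]
    has for contour integrals. *)
Definition cauchy_kernel (z y : C) : C := y * / (y - z).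

Lemma holo_cauchy_kernel (z y : C) : y <> z -> holo (cauchy_kernel z) y.
Proof.
  intros Hy. apply holo_mult. apply holo_id.
  apply (holo_comp Cinv (fun y => y - z)).
  - apply holo_inv. intros E. apply Hy. replace y with (y - z + z) by ring. rewrite E. ring.
  - apply holo_minus. apply holo_id. apply holo_const.
Qed.

Lemma Cmod_neq (y z : C) : Cmod y <> Cmod z -> y <> z.
Proof. intros H E. apply H. now rewrite E. Qed.

Lemma Cminus_neq_0 (y z : C) : y <> z -> y - z <> 0.
Proof. intros H E. apply H. replace y with (y - z + z) by ring. rewrite E. ring. Qed.

Lemma circ_cont_cauchy (f : C -> C) (z : C) (r : R) : circ_cont f r -> r <> Cmod z ->
  circ_cont (fun y => f y * cauchy_kernel z y) r.
Proof.
  intros Hf Hr. apply circ_cont_mult; auto. intros y Hy.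
  apply holo_ccont, holo_cauchy_kernel, Cmod_neq. now rewrite Hy.
Qed.

(** On the circle [|y| = r > |z|] the kernel is the geometric series
    [sum (z / y) ^ k] over [k >= 0]. *)
Lemma cauchy_outer_series (f : C -> C) (z : C) (r : R) : (Cmod z < r)%R -> circ_cont f r ->
  is_Cseries (fun k => circ_int (fun y => f y * / y ^ k) r * z ^ k)
    (circ_int (fun y => f y * cauchy_kernel z y) r).
Proof.
  intros Hz Hf.
  assert (Hm := Cmod_ge_0 z). assert (Hr : (0 < r)%R) by lra.
  destruct (circ_bounded f r Hr Hf) as [A [HA0 HA]].
  assert (HC : forall k, circ_cont (fun y => f y * / y ^ k) r).
  { intros k. apply circ_cont_mult; auto. now apply circ_cont_inv_pow. }
  apply (@is_series_ext C_AbsRing C_NormedModule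
    (fun k => circ_int (fun y => z ^ k * (f y * / y ^ k)) r)).
  { intros k. rewrite circ_int_scal by auto. apply Cmult_comm. }
  apply circ_int_series with (A := (A * (Cmod z / (r - Cmod z)))%R) (q := (Cmod z / r)%R).
  - exact Hr.
  - split. apply Rdiv_le_0_compat; lra. apply Rlt_div_l; lra.
  - intros k. apply circ_cont_mult. apply circ_cont_const. apply HC.
  - apply circ_cont_cauchy; auto. lra.
  - intros n t Ht. specialize (HA t Ht).
    assert (Hy := Cmod_circle r t Hr). set (y := circle r t) in *.
    assert (Hy0 : y <> 0) by now apply Cmod_pos_neq_0 with r.
    assert (Hyz : y - z <> 0) by (apply Cminus_neq_0, Cmod_neq; lra).
    assert (E : @eq C (sum_n (fun k => z ^ k * (f y * / y ^ k)) n)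
      (f y * cauchy_kernel z y - f y * (z ^ n * / y ^ n) * (z / (y - z)))).
    { unfold cauchy_kernel. induction n as [|n IH].
      - rewrite Csum_O. simpl. field. auto.
      - rewrite Csum_S, IH. rewrite !Cpow_S. field.
        repeat split; auto. now apply Cpow_nz. }
    rewrite E.
    replace (f y * cauchy_kernel z y -
      (f y * cauchy_kernel z y - f y * (z ^ n * / y ^ n) * (z / (y - z))))
      with (f y * (z / (y - z)) * (z ^ n * / y ^ n)) by ring.
    assert (Hn := Cpow_nz y n Hy0).
    rewrite !Cmod_mult, Cmod_div, Cmod_inv, !Cmod_pow, Hy by auto.
    replace (Cmod z ^ n * / r ^ n)%R with ((Cmod z / r) ^ n)%R
      by (unfold Rdiv; now rewrite Rpow_mult_distr, pow_inv).
    apply Rmult_le_compat_r. { apply pow_le, Rdiv_le_0_compat; lra. }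
    assert (Hd : (r - Cmod z <= Cmod (y - z))%R).
    { generalize (Cmod_triangle_minus y z). lra. }
    apply Rmult_le_compat; auto using Cmod_ge_0.
    { apply Rdiv_le_0_compat; lra. }
    unfold Rdiv. apply Rmult_le_compat_l; auto.
    apply Rinv_le_contravar; lra.
Qed.

(** On the circle [|y| = r < |z|] the kernel is [- sum (y / z) ^ (k + 1)] over
    [k >= 0]. *)
Lemma cauchy_inner_series (f : C -> C) (z : C) (r : R) : (0 < r < Cmod z)%R -> circ_cont f r ->
  is_Cseries (fun k => circ_int (fun y => f y * y ^ S k) r / z ^ S k)
    (- circ_int (fun y => f y * cauchy_kernel z y) r).
Proof.
  intros Hr Hf.
  assert (Hz0 : z <> 0) by (apply Cmod_gt_0; lra).
  destruct (circ_bounded f r (proj1 Hr) Hf) as [A [HA0 HA]].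
  assert (HC : forall k, circ_cont (fun y => f y * y ^ S k) r).
  { intros k. apply circ_cont_mult; auto. apply circ_cont_pow. }
  assert (HK : circ_cont (fun y => f y * cauchy_kernel z y) r).
  { apply circ_cont_cauchy; auto. lra. }
  apply (@is_series_ext C_AbsRing C_NormedModule
    (fun k => circ_int (fun y => / z ^ S k * (f y * y ^ S k)) r)).
  { intros k. rewrite circ_int_scal by (apply HC || lra). apply Cmult_comm. }
  replace (- circ_int (fun y => f y * cauchy_kernel z y) r)
    with (circ_int (fun y => (- (1)) * (f y * cauchy_kernel z y)) r)
    by (rewrite circ_int_scal by (apply HK || lra); ring).
  apply circ_int_series with (A := (A * (r / (Cmod z - r)))%R) (q := (r / Cmod z)%R).
  - lra.
  - split. apply Rdiv_le_0_compat; lra. apply Rlt_div_l; lra.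
  - intros k. apply circ_cont_mult. apply circ_cont_const. apply HC.
  - apply circ_cont_mult; auto. apply circ_cont_const.
  - intros n t Ht. specialize (HA t Ht).
    assert (Hy := Cmod_circle r t (proj1 Hr)). set (y := circle r t) in *.
    assert (Hyz : y - z <> 0) by (apply Cminus_neq_0, Cmod_neq; lra).
    assert (E : @eq C (sum_n (fun k => / z ^ S k * (f y * y ^ S k)) n)
      (- (1) * (f y * cauchy_kernel z y) + f y * (y ^ S n * / z ^ S n) * (y / (y - z)))).
    { unfold cauchy_kernel. induction n as [|n IH].
      - rewrite Csum_O. simpl. field. auto.
      - rewrite Csum_S, IH. rewrite (Cpow_S y (S n)), (Cpow_S z (S n)). field.
        repeat split; auto. now apply Cpow_nz. }
    rewrite E.
    replace (- (1) * (f y * cauchy_kernel z y) -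
      (- (1) * (f y * cauchy_kernel z y) + f y * (y ^ S n * / z ^ S n) * (y / (y - z))))
      with (- (f y * (y / (y - z)) * (y ^ S n * / z ^ S n))) by ring.
    assert (Hn := Cpow_nz z (S n) Hz0).
    rewrite Cmod_opp, !Cmod_mult, Cmod_div, Cmod_inv, !Cmod_pow, Hy by auto.
    replace (r ^ S n * / Cmod z ^ S n)%R with ((r / Cmod z) ^ S n)%R
      by (unfold Rdiv; now rewrite Rpow_mult_distr, pow_inv).
    assert (Hq : (0 <= r / Cmod z <= 1)%R).
    { split. apply Rdiv_le_0_compat; lra. apply Rle_div_l; lra. }
    assert (Hd : (Cmod z - r <= Cmod (y - z))%R).
    { generalize (Cmod_triangle_minus z y). rewrite Cmod_minus_sym. lra. }
    assert (Hp : (0 <= (r / Cmod z) ^ n)%R) by (apply pow_le; lra).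
    apply Rmult_le_compat.
    + apply Rmult_le_pos. apply Cmod_ge_0. apply Rdiv_le_0_compat; lra.
    + apply pow_le; lra.
    + apply Rmult_le_compat; auto using Cmod_ge_0.
      { apply Rdiv_le_0_compat; lra. }
      unfold Rdiv. apply Rmult_le_compat_l; [lra|].
      apply Rinv_le_contravar; lra.
    + simpl. nra.
Qed.

Lemma circ_int_kernel_outer (z : C) (r : R) : (Cmod z < r)%R ->
  circ_int (cauchy_kernel z) r = RtoC (2 * PI).
Proof.
  intros Hz. assert (Hr : (0 < r)%R) by (generalize (Cmod_ge_0 z); lra).
  rewrite (circ_int_ext _ (fun y => 1 * cauchy_kernel z y)) by (auto; intros; ring).
  assert (H := cauchy_outer_series (fun _ => 1) z r Hz (circ_cont_const 1 r)).
  rewrite (is_Cseries_single _ _ 0%nat H).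
  - rewrite (circ_int_ext _ (fun _ => 1)) by (auto; intros; simpl; field).
    rewrite circ_int_const. simpl. ring.
  - intros k Hk.
    rewrite (circ_int_ext _ (fun y => y ^ 0 * / y ^ k)) by auto.
    rewrite circ_int_pow_quot_0 by auto. ring.
Qed.

Lemma circ_int_kernel_inner (z : C) (r : R) : (0 < r < Cmod z)%R ->
  circ_int (cauchy_kernel z) r = 0.
Proof.
  intros Hr. assert (Hr0 := proj1 Hr).
  rewrite (circ_int_ext _ (fun y => 1 * cauchy_kernel z y)) by (auto; intros; ring).
  assert (H := cauchy_inner_series (fun _ => 1) z r Hr (circ_cont_const 1 r)).
  assert (H0 : forall k, circ_int (fun y => 1 * y ^ S k) r / z ^ S k = 0).
  { intros k.
    rewrite (circ_int_ext _ (fun y => y ^ S k * / y ^ 0)) by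
      (auto; intros; simpl; field).
    rewrite circ_int_pow_quot_0 by auto. unfold Cdiv. ring. }
  apply (is_Cseries_single _ _ 0%nat) in H; [|intros; apply H0].
  cbv beta in H. rewrite H0 in H.
  replace (circ_int (fun y => 1 * cauchy_kernel z y) r)
    with (- - circ_int (fun y => 1 * cauchy_kernel z y) r) by ring.
  rewrite H. ring.
Qed.

(** The function [g y = (f y - f z) y / (y - z)], extended by continuity at
    [z], is differentiable off [z], so its integrals over the two circles agree.
    The kernel itself integrates to [2 pi] on the outer circle and to 0 on the
    inner one. *)
Lemma cauchy_annulus (f : C -> C) (z : C) (r1 r2 : R) : (0 < r1 < Cmod z)%R -> (Cmod z < r2)%R ->
  (forall y, (r1 <= Cmod y <= r2)%R -> holo f y) ->
  circ_int (fun y => f y * cauchy_kernel z y) r2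
  - circ_int (fun y => f y * cauchy_kernel z y) r1 = RtoC (2 * PI) * f z.
Proof.
  intros Hr1 Hr2 Hf.
  destruct (Hf z ltac:(lra)) as [l Hl].
  set (g := fun y => if Ceq_dec y z then l * y else (f y - f z) * cauchy_kernel z y).
  assert (Hgo : forall r, (r1 <= r <= r2)%R -> r <> Cmod z ->
    circ_int g r = circ_int (fun y => f y * cauchy_kernel z y) r
                   - f z * circ_int (cauchy_kernel z) r).
  { intros r Hr Hrz.
    assert (Hk : circ_cont (cauchy_kernel z) r).
    { intros y Hy. apply holo_ccont, holo_cauchy_kernel, Cmod_neq. now rewrite Hy. }
    assert (Hfc : circ_cont f r) by (intros y Hy; apply holo_ccont, Hf; lra).
    rewrite <- circ_int_scal, <- circ_int_minus; auto; try lra.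
    - apply circ_int_ext. lra. intros y Hy. unfold g.
      destruct (Ceq_dec y z) as [E|_]; [exfalso; apply Hrz; now rewrite <- Hy, E|]. ring.
    - apply circ_cont_cauchy; auto.
    - apply circ_cont_mult; auto. apply circ_cont_const. }
  assert (Hgh : forall y, (r1 <= Cmod y <= r2)%R -> y <> z -> holo g y).
  { intros y Hy Hyz.
    apply (@ex_derive_ext_loc C_AbsRing C_NormedModule
      (fun y => (f y - f z) * cauchy_kernel z y)).
    - apply locally_C, locally_Cmod.
      exists (Cmod (y - z)). split. now apply Cmod_gt_0, Cminus_neq_0.
      intros x Hx. unfold g. destruct (Ceq_dec x z) as [E|_]; [|reflexivity].
      rewrite E, Cmod_minus_sym in Hx. lra.
    - apply holo_mult. apply holo_minus. now apply Hf. apply holo_const.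
      now apply holo_cauchy_kernel. }
  assert (Hgc : ccont g z).
  { assert (Hphi : ccont (fun y => if Ceq_dec y z then l else (f y - f z) * / (y - z)) z).
    { apply ccont_Cmod. intros e He.
      destruct (proj1 (is_C_derive_Cmod f z l) Hl (e / 2)%R ltac:(lra)) as [d [Hd H]].
      exists d. split; auto. intros y Hy. specialize (H y Hy).
      destruct (Ceq_dec z z) as [_|N]; [|now destruct N].
      destruct (Ceq_dec y z) as [E|N].
      - replace (l - l) with (RtoC 0) by ring. now rewrite Cmod_0.
      - assert (Hyz := Cminus_neq_0 y z N).
        assert (Hp : (0 < Cmod (y - z))%R) by now apply Cmod_gt_0.
        replace ((f y - f z) * / (y - z) - l)
          with ((f y - f z - (y - z) * l) / (y - z)) by (field; auto).
        rewrite Cmod_div by auto. apply Rlt_div_l; auto.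
        assert (0 < e * Cmod (y - z))%R by (apply Rmult_lt_0_compat; auto). lra. }
    assert (Hg : forall y : C,
      (if Ceq_dec y z then l else (f y - f z) * / (y - z)) * y = g y).
    { intros y. unfold g, cauchy_kernel. destruct (Ceq_dec y z). reflexivity. ring. }
    apply (@continuous_ext C_UniformSpace C_UniformSpace _ _ z Hg).
    apply (Ccontinuous_mult _ (fun y : C => y)). exact Hphi. apply continuous_id. }
  assert (HE : circ_int g r1 = circ_int g r2).
  { apply circ_int_const_across with (Cmod z); auto.
    - intros y Hy. destruct (Ceq_dec y z) as [->|N]. exact Hgc.
      apply holo_ccont, Hgh; auto.
    - intros y Hy N. apply Hgh; auto. now apply Cmod_neq. }
  rewrite !Hgo in HE by lra.
  rewrite (circ_int_kernel_inner z r1), (circ_int_kernel_outer z r2) in HE by lra.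
  replace (circ_int (fun y => f y * cauchy_kernel z y) r1) with
    (circ_int (fun y => f y * cauchy_kernel z y) r1 - f z * 0) by ring.
  rewrite HE. ring.
Qed.

(** The integral [(1 / (2 pi)) circ_int (f y / y ^ k) r], written without
    integer powers. *)
Definition laurent_coef (f : C -> C) (r : R) (k : Z) : C :=
  / RtoC (2 * PI) *
  (if (0 <=? k)%Z then circ_int (fun y => f y * / y ^ Z.to_nat k) r
   else circ_int (fun y => f y * y ^ Z.to_nat (- k)) r).

Lemma laurent_coef_nonneg f r k : laurent_coef f r (Z.of_nat k) =
  / RtoC (2 * PI) * circ_int (fun y => f y * / y ^ k) r.
Proof.
  unfold laurent_coef. rewrite (proj2 (Z.leb_le _ _) (Nat2Z.is_nonneg k)).
  now rewrite Nat2Z.id.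
Qed.

Lemma laurent_coef_neg f r k : laurent_coef f r (- Z.of_nat (S k))%Z =
  / RtoC (2 * PI) * circ_int (fun y => f y * y ^ S k) r.
Proof.
  unfold laurent_coef. rewrite (proj2 (Z.leb_gt _ _)) by lia.
  now rewrite Z.opp_involutive, Nat2Z.id.
Qed.

Lemma circ_int_punctured (f : C -> C) (rad r r' : R) :
  (forall y, (0 < Cmod y < rad)%R -> holo f y) ->
  (0 < r < rad)%R -> (0 < r' < rad)%R -> circ_int f r = circ_int f r'.
Proof.
  intros Hf Hr Hr'. destruct (Rle_dec r r').
  - apply circ_int_holo_const. lra. intros z Hz. apply Hf. lra.
  - symmetry. apply circ_int_holo_const. lra. intros z Hz. apply Hf. lra.
Qed.

(** Cauchy's formula on an annulus around [z], with both kernels expanded.  The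
    two boundary radii depend on [z], but the coefficients do not depend on the
    radius, so they may all be taken at [rad / 2]. *)
Theorem laurent_expansion (f : C -> C) (rad : R) (z : C) :
  (forall y, (0 < Cmod y < rad)%R -> holo f y) -> (0 < Cmod z < rad)%R ->
  exists s t,
    is_Cseries (fun k => laurent_coef f (rad / 2) (Z.of_nat k) * z ^ k) s /\
    is_Cseries (fun k => laurent_coef f (rad / 2) (- Z.of_nat (S k))%Z / z ^ S k) t /\
    f z = s + t.
Proof.
  intros Hf Hz.
  set (r1 := (Cmod z / 2)%R). set (r2 := ((Cmod z + rad) / 2)%R).
  assert (H1 : (0 < r1 < Cmod z)%R) by (unfold r1; lra).
  assert (H2 : (Cmod z < r2 < rad)%R) by (unfold r2; lra).
  assert (Hc : forall r, (0 < r < rad)%R -> circ_cont f r).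
  { intros r Hr y Hy. apply holo_ccont, Hf. lra. }
  assert (Hpi : RtoC (2 * PI) <> 0).
  { intros E. apply RtoC_inj in E. generalize two_PI_pos. lra. }
  exists (/ RtoC (2 * PI) * circ_int (fun y => f y * cauchy_kernel z y) r2).
  exists (/ RtoC (2 * PI) * - circ_int (fun y => f y * cauchy_kernel z y) r1).
  split; [|split].
  - apply (@is_series_ext C_AbsRing C_NormedModule (fun k =>
      / RtoC (2 * PI) * (circ_int (fun y => f y * / y ^ k) r2 * z ^ k))).
    { intros k. C_eq. rewrite laurent_coef_nonneg.
      rewrite (circ_int_punctured (fun y => f y * / y ^ k) rad r2 (rad / 2)); try lra. ring.
      intros y Hy. apply holo_mult. now apply Hf. apply holo_inv_pow, Cmod_gt_0. lra. }
    apply (@is_series_scal C_AbsRing C_NormedModule).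
    apply cauchy_outer_series. lra. apply Hc. lra.
  - apply (@is_series_ext C_AbsRing C_NormedModule (fun k =>
      / RtoC (2 * PI) * (circ_int (fun y => f y * y ^ S k) r1 / z ^ S k))).
    { intros k. C_eq. rewrite laurent_coef_neg.
      rewrite (circ_int_punctured (fun y => f y * y ^ S k) rad r1 (rad / 2)); try lra.
      unfold Cdiv. ring.
      intros y Hy. apply holo_mult. now apply Hf. apply holo_pow. }
    apply (@is_series_scal C_AbsRing C_NormedModule).
    apply cauchy_inner_series. lra. apply Hc. lra.
  - assert (HC := cauchy_annulus f z r1 r2 H1 (proj1 H2)
      (fun y Hy => Hf y ltac:(lra))).
    replace (f z) with (/ RtoC (2 * PI) * (RtoC (2 * PI) * f z)) by (field; exact Hpi).
    rewrite <- HC. ring.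
Qed.

(** * Laurent series of a function at a point *)

Lemma isolated_singularity_laurent (w : C -> C) (z0 : C) :
  isolated_singularity w z0 -> exists a, is_laurent w z0 a.
Proof.
  intros [r [Hr Hw]].
  exists (laurent_coef (fun h => w (z0 + h)) (r / 2)). exists r. split; auto.
  intros z Hz.
  destruct (laurent_expansion (fun h => w (z0 + h)) r (z - z0)) as (s & t & Hs & Ht & E).
  - intros y Hy. apply (holo_comp w (fun h => z0 + h)).
    + apply Hw. unfold punctured_disk. now replace (z0 + y - z0) with y by ring.
    + apply (@ex_derive_plus C_AbsRing C_NormedModule (fun _ => z0) (fun h => h)).
      apply holo_const. apply holo_id.
  - exact Hz.
  - exists s, t. repeat split; auto. rewrite <- E. f_equal. ring.
Qed.

Lemma is_laurent_lincomb (w1 w2 : C -> C) (z0 : C) (a1 a2 : Z -> C) (c1 c2 : C) :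
  is_laurent w1 z0 a1 -> is_laurent w2 z0 a2 ->
  is_laurent (fun z => c1 * w1 z + c2 * w2 z) z0 (fun k => c1 * a1 k + c2 * a2 k).
Proof.
  intros [r1 [Hr1 H1]] [r2 [Hr2 H2]].
  exists (Rmin r1 r2). split. now apply Rmin_glb_lt.
  intros z [Hz Hzr].
  destruct (H1 z) as (s1 & t1 & Hs1 & Ht1 & E1).
  { split; auto. eapply Rlt_le_trans; [exact Hzr | apply Rmin_l]. }
  destruct (H2 z) as (s2 & t2 & Hs2 & Ht2 & E2).
  { split; auto. eapply Rlt_le_trans; [exact Hzr | apply Rmin_r]. }
  assert (L : forall u1 u2 l1 l2, is_Cseries u1 l1 -> is_Cseries u2 l2 ->
    is_Cseries (fun k => c1 * u1 k + c2 * u2 k) (c1 * l1 + c2 * l2)).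
  { intros u1 u2 l1 l2 HU1 HU2.
    apply (@is_series_plus C_AbsRing C_NormedModule (fun k => c1 * u1 k) (fun k => c2 * u2 k));
      now apply (@is_series_scal C_AbsRing C_NormedModule). }
  exists (c1 * s1 + c2 * s2), (c1 * t1 + c2 * t2). repeat split.
  - eapply (@is_series_ext C_AbsRing C_NormedModule); [|apply (L _ _ _ _ Hs1 Hs2)].
    intros k. C_eq. ring.
  - eapply (@is_series_ext C_AbsRing C_NormedModule); [|apply (L _ _ _ _ Ht1 Ht2)].
    intros k. C_eq. unfold Cdiv. ring.
  - rewrite E1, E2. ring.
Qed.

Lemma Cmod_shift (z0 : C) (r : R) : (0 <= r)%R -> Cmod (z0 + RtoC r - z0) = r.
Proof.
  intros Hr. replace (z0 + RtoC r - z0) with (RtoC r) by ring.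
  rewrite Cmod_R. apply Rabs_right. lra.
Qed.

(** Multiply the expansion of 0 by [y ^ (j + 1)] and integrate term by term
    over a circle; only the term of index [- (j + 1)] survives. *)
Lemma laurent_zero_principal (c : Z -> C) (z0 : C) (j : nat) :
  is_laurent (fun _ => 0) z0 c -> c (- Z.of_nat (S j))%Z = 0.
Proof.
  intros [R0 [HR0 H]].
  (* Convergence at the radii [2 r] and [r / 2] bounds the terms of the regular
     and of the principal series at radius [r] by multiples of [(1 / 2) ^ k]. *)
  set (r := (R0 / 4)%R). assert (Hr : (0 < r)%R) by (unfold r; lra).
  destruct (H (z0 + RtoC (2 * r))) as (s1 & _ & Hs1 & _ & _).
  { unfold punctured_disk. rewrite Cmod_shift by lra. unfold r; lra. }
  destruct (H (z0 + RtoC (r / 2))) as (_ & t2 & _ & Ht2 & _).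
  { unfold punctured_disk. rewrite Cmod_shift by lra. unfold r; lra. }
  destruct (is_Cseries_bounded _ _ Hs1) as [A HA].
  destruct (is_Cseries_bounded _ _ Ht2) as [B HB].
  assert (HA' : forall y, Cmod y = r -> forall k,
    (Cmod (c (Z.of_nat k) * y ^ k) <= A * (1 / 2) ^ k)%R).
  { intros y Hy k. specialize (HA k). rewrite Cmod_mult, Cmod_pow in *.
    rewrite Cmod_shift in HA by lra. rewrite Hy.
    replace (r ^ k)%R with ((2 * r) ^ k * (1 / 2) ^ k)%R
      by (rewrite <- Rpow_mult_distr; f_equal; field).
    rewrite <- Rmult_assoc. apply Rmult_le_compat_r; auto. apply pow_le; lra. }
  assert (HB' : forall y, Cmod y = r -> forall k,
    (Cmod (c (- Z.of_nat (S k))%Z * / y ^ S k) <= B * (1 / 2) ^ k)%R).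
  { intros y Hy k. specialize (HB k).
    assert (Hy0 : y <> 0) by now apply Cmod_pos_neq_0 with r.
    assert (Hh0 : z0 + RtoC (r / 2) - z0 <> 0).
    { apply Cmod_gt_0. rewrite Cmod_shift; lra. }
    assert (Hp : (0 < r ^ S k)%R) by now apply pow_lt.
    assert (Hp2 : (0 < 2 ^ k)%R) by (apply pow_lt; lra).
    rewrite Cmod_div in HB by now apply Cpow_nz.
    rewrite Cmod_pow, Cmod_shift in HB by lra.
    rewrite Cmod_mult, Cmod_inv, Cmod_pow, Hy by now apply Cpow_nz.
    set (m := Cmod (c (- Z.of_nat (S k))%Z)) in *.
    assert (Hm : (0 <= m)%R) by apply Cmod_ge_0.
    assert (E : (m * / r ^ S k = (m / (r / 2) ^ S k) * (1 / 2) ^ S k)%R).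
    { unfold Rdiv. rewrite !Rpow_mult_distr, pow1. field.
      split; [|lra]. apply pow_nonzero. lra. }
    rewrite E.
    assert (0 <= m / (r / 2) ^ S k)%R.
    { apply Rdiv_le_0_compat; auto. apply pow_lt. lra. }
    assert (0 <= (1 / 2) ^ k)%R by (apply pow_le; lra).
    apply Rmult_le_compat; auto; simpl; nra. }
  set (u := fun k y => y ^ S j * (c (Z.of_nat k) * y ^ k
                     + c (- Z.of_nat (S k))%Z * / y ^ S k)).
  assert (Hpos : circ_cont (fun y => y ^ S j) r) by apply circ_cont_pow.
  assert (Hu1 : forall k, circ_cont (fun y => y ^ (S j + k) * / y ^ 0) r).
  { intros k. apply circ_cont_mult. apply circ_cont_pow. now apply circ_cont_inv_pow. }
  assert (Hu2 : forall k, circ_cont (fun y => y ^ S j * / y ^ S k) r).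
  { intros k. apply circ_cont_mult. apply circ_cont_pow. now apply circ_cont_inv_pow. }
  assert (Hint : forall k, circ_int (u k) r =
    c (- Z.of_nat (S k))%Z * circ_int (fun y => y ^ S j * / y ^ S k) r).
  { intros k.
    rewrite (circ_int_ext _ (fun y => c (Z.of_nat k) * (y ^ (S j + k) * / y ^ 0)
      + c (- Z.of_nat (S k))%Z * (y ^ S j * / y ^ S k)) r Hr).
    2:{ intros y Hy. unfold u. rewrite Cpow_add_r.
        change (y ^ 0) with (RtoC 1).
        replace (/ RtoC 1) with (RtoC 1) by field. ring. }
    rewrite circ_int_plus; auto.
    - rewrite !circ_int_scal by auto. rewrite circ_int_pow_quot_0 by (auto; lia). ring.
    - apply circ_cont_mult; auto. apply circ_cont_const.
    - apply circ_cont_mult; auto. apply circ_cont_const. }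
  assert (HS : is_Cseries (fun k => circ_int (u k) r) (circ_int (fun _ => 0) r)).
  { apply circ_int_series with (A := (r ^ S j * ((A + B)))%R) (q := (1 / 2)%R); auto.
    - lra.
    - intros k. apply circ_cont_mult; auto.
      apply circ_cont_plus; apply circ_cont_mult; try apply circ_cont_const.
      apply circ_cont_pow. now apply circ_cont_inv_pow.
    - apply circ_cont_const.
    - intros n t _. assert (Hy := Cmod_circle r t Hr). set (y := circle r t) in *.
      destruct (H (z0 + y)) as (s & t' & Hs & Ht & E).
      { unfold punctured_disk. replace (z0 + y - z0) with y by ring.
        rewrite Hy. unfold r; lra. }
      unfold is_regular_sum in Hs. unfold is_principal_sum in Ht.
      replace (z0 + y - z0) with y in Hs, Ht by ring.
      assert (T1 := Cseries_tail _ s A (1 / 2) ltac:(lra) Hs (HA' y Hy) n).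
      assert (T2 := Cseries_tail _ t' B (1 / 2) ltac:(lra) Ht (HB' y Hy) n).
      assert (ES : @eq C (sum_n (fun k => u k y) n)
        (y ^ S j * (sum_n (fun k => c (Z.of_nat k) * y ^ k) n
                  + sum_n (fun k => c (- Z.of_nat (S k))%Z / y ^ S k) n))).
      { clear - u. induction n as [|n IH].
        - rewrite !Csum_O. reflexivity.
        - rewrite !Csum_S, IH. unfold u, Cdiv. ring. }
      rewrite ES.
      set (S1 := sum_n (fun k => c (Z.of_nat k) * y ^ k) n) in *.
      set (S2 := sum_n (fun k => c (- Z.of_nat (S k))%Z / y ^ S k) n) in *.
      replace (0 - y ^ S j * (S1 + S2)) with (y ^ S j * ((s - S1) + (t' - S2))).
      2:{ replace (y ^ S j * (s - S1 + (t' - S2)))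
            with (y ^ S j * (s + t') - y ^ S j * (S1 + S2)) by ring.
          rewrite <- E. ring. }
      rewrite Cmod_mult, Cmod_pow, Hy.
      replace (r ^ S j * (A + B) * (1 / 2) ^ n)%R
        with (r ^ S j * ((A * (1 / 2) ^ S n / (1 - 1 / 2)) + (B * (1 / 2) ^ S n / (1 - 1 / 2))))%R
        by (simpl; field).
      apply Rmult_le_compat_l. { apply pow_le; lra. }
      eapply Rle_trans. apply Cmod_triangle. now apply Rplus_le_compat. }
  apply (is_Cseries_single _ _ j) in HS.
  2:{ intros k Hk. rewrite Hint, circ_int_pow_quot_0 by (auto; lia). ring. }
  cbv beta in HS. rewrite Hint, circ_int_const in HS.
  rewrite (circ_int_ext _ (fun _ => 1) r Hr) in HS.
  2:{ intros y Hy. apply Cinv_r. apply Cpow_nz. now apply Cmod_pos_neq_0 with r. }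
  rewrite circ_int_const in HS.
  assert (Hpi : RtoC (2 * PI) <> 0).
  { intros E. apply RtoC_inj in E. generalize two_PI_pos. lra. }
  replace (c (- Z.of_nat (S j))%Z)
    with (/ RtoC (2 * PI) * (c (- Z.of_nat (S j))%Z * (RtoC (2 * PI) * 1)))
    by (field; exact Hpi).
  rewrite <- HS. ring.
Qed.

Lemma laurent_principal_unique (w : C -> C) (z0 : C) (a b : Z -> C) (j : nat) :
  is_laurent w z0 a -> is_laurent w z0 b ->
  a (- Z.of_nat (S j))%Z = b (- Z.of_nat (S j))%Z.
Proof.
  intros Ha Hb.
  assert (H := is_laurent_lincomb w w z0 a b 1 (- (1)) Ha Hb).
  assert (H0 : is_laurent (fun _ => 0) z0 (fun k => 1 * a k + - (1) * b k)).
  { destruct H as [r [Hr H]]. exists r. split; auto. intros z Hz.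
    destruct (H z Hz) as (s & t & Hs & Ht & E). exists s, t. repeat split; auto.
    rewrite <- E. ring. }
  apply (laurent_zero_principal _ _ j) in H0. cbv beta in H0.
  replace (a (- Z.of_nat (S j))%Z) with
    (1 * a (- Z.of_nat (S j))%Z + - (1) * b (- Z.of_nat (S j))%Z + b (- Z.of_nat (S j))%Z)
    by ring.
  rewrite H0. ring.
Qed.

Lemma iota_C_unique (P : C -> Prop) (l : C) : P l -> (forall m, P m -> m = l) ->
  @iota C_CompleteNormedModule P = l.
Proof.
  intros Hl Hu. apply Hu.
  apply (@iota_correct C_AbsRing C_CompleteNormedModule P).
  exists l. split; auto. intros m Hm. symmetry. auto.
Qed.

Lemma principal_part_eq (w : C -> C) (z0 z t : C) (a : Z -> C) :
  is_laurent w z0 a -> is_principal_sum a z0 z t -> principal_part w z0 z = t.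
Proof.
  intros Ha Ht. apply iota_C_unique.
  - now exists a.
  - intros m [b [Hb Hm]]. apply (is_Cseries_unique _ _ _ Hm).
    eapply (@is_series_ext C_AbsRing C_NormedModule); [|exact Ht].
    intros k. C_eq. now rewrite (laurent_principal_unique w z0 a b k Ha Hb).
Qed.

(** Convergence at one nonzero radius [r] bounds the coefficients by
    [A / r ^ k], so the sum differs from [a 0] by at most [A q / (1 - q)] with
    [q = |z - z0| / r]. *)
Lemma regular_sum_limit (a : Z -> C) (z0 : C) (r : R) : (0 < r)%R ->
  (exists s, is_regular_sum a z0 (z0 + RtoC r) s) ->
  forall e, (0 < e)%R -> exists d, (0 < d)%R /\ forall z s,
    (Cmod (z - z0) < d)%R -> is_regular_sum a z0 z s -> (Cmod (s - a 0%Z) < e)%R.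
Proof.
  intros Hr [s0 Hs0] e He.
  destruct (is_Cseries_bounded _ _ Hs0) as [A HA].
  assert (HA' : forall k, (Cmod (a (Z.of_nat k)) * r ^ k <= A)%R).
  { intros k. specialize (HA k). now rewrite Cmod_mult, Cmod_pow, Cmod_shift in HA by lra. }
  assert (HA0 : (0 <= A)%R).
  { generalize (HA 0%nat). generalize (Cmod_ge_0 (a (Z.of_nat 0) * (z0 + RtoC r - z0) ^ 0)). lra. }
  (* For [q < q0] one has [A q / (1 - q) <= 2 A q < e]. *)
  set (q0 := Rmin (1 / 2) (e / (2 * (A + 1)))).
  assert (Hq0 : (0 < q0)%R).
  { apply Rmin_glb_lt. lra. apply Rdiv_lt_0_compat; lra. }
  exists (q0 * r)%R. split. now apply Rmult_lt_0_compat.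
  intros z s Hz Hs.
  set (q := (Cmod (z - z0) / r)%R).
  assert (Hq : (0 <= q < q0)%R).
  { split. apply Rdiv_le_0_compat; auto. apply Cmod_ge_0. now apply Rlt_div_l. }
  assert (Hqa : (q < 1 / 2)%R) by (generalize (Rmin_l (1 / 2) (e / (2 * (A + 1)))); fold q0; lra).
  assert (Hqb : (q < e / (2 * (A + 1)))%R)
    by (generalize (Rmin_r (1 / 2) (e / (2 * (A + 1)))); fold q0; lra).
  apply Rlt_div_r in Hqb; [|lra].
  assert (T := Cseries_tail _ s A q ltac:(lra) Hs).
  assert (Hk : forall k, (Cmod (a (Z.of_nat k) * (z - z0) ^ k) <= A * q ^ k)%R).
  { intros k. rewrite Cmod_mult, Cmod_pow.
    replace (Cmod (z - z0) ^ k)%R with (r ^ k * q ^ k)%R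
      by (rewrite <- Rpow_mult_distr; f_equal; unfold q; field; lra).
    rewrite <- Rmult_assoc. apply Rmult_le_compat_r; auto. apply pow_le; lra. }
  specialize (T Hk 0%nat). rewrite Csum_O in T.
  replace (a (Z.of_nat 0) * (z - z0) ^ 0) with (a 0%Z) in T by (simpl; ring).
  eapply Rle_lt_trans. exact T.
  simpl. apply Rlt_div_l; [lra|]. nra.
Qed.

(** A punctured neighbourhood filter of [C] is proper, so limits are unique. *)
Lemma limC_eq (f : C -> C) (z0 l : C) :
  @filterlim C C f (@locally' C_UniformSpace z0) (@locally C_UniformSpace l) ->
  limC f z0 = l.
Proof.
  intros H. apply iota_C_unique; auto. intros m Hm.
  assert (PF : ProperFilter' (@locally' C_UniformSpace z0)).
  { constructor.
    - intros HF. apply locally_Cmod in HF. destruct HF as [d [Hd HF]].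
      apply (HF (z0 + RtoC (d / 2))).
      + rewrite Cmod_shift; lra.
      + intros E. apply (f_equal (fun x => Cmod (x - z0))) in E.
        rewrite Cmod_shift in E by lra.
        replace (z0 - z0) with (RtoC 0) in E by ring. rewrite Cmod_0 in E. lra.
    - apply within_filter, locally_filter. }
  exact (@filterlim_locally_unique C C_AbsRing C_NormedModule _ PF f m l Hm H).
Qed.

(** Near [z0] the function minus its principal part is the regular half of any
    Laurent expansion. *)
Theorem reglim_laurent (w : C -> C) (z0 : C) (a : Z -> C) :
  is_laurent w z0 a -> reglim w z0 = a 0%Z.
Proof.
  intros Ha. apply limC_eq. destruct (Ha) as [r [Hr H]].
  destruct (H (z0 + RtoC (r / 2))) as (s0 & _ & Hs0 & _).
  { unfold punctured_disk. rewrite Cmod_shift by lra. lra. }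
  assert (L := regular_sum_limit a z0 (r / 2) ltac:(lra) (ex_intro _ s0 Hs0)).
  intros P HP. apply locally_Cmod in HP. destruct HP as [e [He HP]].
  destruct (L e He) as [d [Hd HL]].
  unfold filtermap, locally', within. apply locally_Cmod.
  exists (Rmin d r). split. now apply Rmin_glb_lt.
  intros z Hz Hne. apply HP.
  assert (Hzd : (Cmod (z - z0) < d)%R) by (eapply Rlt_le_trans; [exact Hz | apply Rmin_l]).
  assert (Hzr : (Cmod (z - z0) < r)%R) by (eapply Rlt_le_trans; [exact Hz | apply Rmin_r]).
  destruct (H z) as (s & t & Hs & Ht & E).
  { split; auto. now apply Cmod_gt_0, Cminus_neq_0. }
  rewrite (principal_part_eq w z0 z t a Ha Ht), E.
  replace (s + t - t) with s by ring. now apply (HL z s).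
Qed.

Theorem theorem2p3 (l0 : C) (w1 w2 : C -> C)
    (hw1 : isolated_singularity w1 l0) (hw2 : isolated_singularity w2 l0)
    (alpha1 alpha2 : C) :
  reglim (fun l => alpha1 * w1 l + alpha2 * w2 l) l0
  = alpha1 * reglim w1 l0 + alpha2 * reglim w2 l0.
Proof.
  destruct (isolated_singularity_laurent w1 l0 hw1) as [a1 H1].
  destruct (isolated_singularity_laurent w2 l0 hw2) as [a2 H2].
  rewrite (reglim_laurent w1 l0 a1 H1), (reglim_laurent w2 l0 a2 H2).
  exact (reglim_laurent _ l0 _ (is_laurent_lincomb w1 w2 l0 a1 a2 alpha1 alpha2 H1 H2)).
Qed.
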